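(* For each fixed real $a\in(0,e]$, the following functions (of $z>0$) are Stieltjes functions: $$F_0(z)=\frac{z}{1+z}\cdot\frac{W(a(1+z))}{\left[W(a(1+z))-W(a)\right]^2},$$ $$F_1(z)=\frac{z\,W\!\left(\frac{a}{1+z}\right)}{\left[W(a)-W\!\left(\frac{a}{1+z}\right)\right]^2}.$$
   Context: $W$ denotes the principal branch of the Lambert $W$ function; for $x>0$, $W(x)$ is the unique positive real number with $W(x)e^{W(x)}=x$. A function $f:(0,\infty)\to\mathbb{R}$ is a Stieltjes function if $f(x)=\alpha+\int_0^\infty\frac{d\mu(t)}{x+t}$ for all $x>0$, where $\alpha\ge 0$ is a constant and $\mu$ is a positive measure on $[0,\infty)$ with $\int_0^\infty(1+t)^{-1}d\mu(t)<\infty$. *)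

(* Defs.v *)
From HB Require Import structures.
From mathcomp Require Import all_boot all_order all_algebra.
From mathcomp Require Import all_classical all_reals all_analysis.

Set Implicit Arguments.
Unset Strict Implicit.
Unset Printing Implicit Defensive.

Import Order.TTheory GRing.Theory Num.Theory.
Import numFieldNormedType.Exports.

Local Open Scope classical_set_scope.
Local Open Scope ring_scope.

(* Restriction to ]0, +oo[ of the principal branch of the Lambert W function;
   the value is meaningful only for 0 < x (see lambertW_gt0, lambertW_expR and
   lambertW_unique). *)
Definition lambertW (R : realType) (x : R) : R :=
  xget 0 [set w : R | 0 < w /\ w * expR w = x].

(* f is only constrained on ]0, +oo[. Restricting the domain of integration to
   `[0, +oo[ makes a Borel measure mu on R play the role of a measure on
   [0, +oo[: only its restriction to that set matters. *)
Definition Stieltjes (R : realType) (f : R -> R) : Prop :=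
  exists (alpha : R) (mu : {measure set (measurableTypeR R) -> \bar R}),
    [/\ 0 <= alpha,
        (\int[mu]_(t in `[0%R, +oo[) ((1 + t)^-1)%:E < +oo)%E &
        forall x : R, 0 < x ->
          (f x)%:E =
            (alpha%:E + \int[mu]_(t in `[0%R, +oo[) ((x + t)^-1)%:E)%E].

Definition F0 (R : realType) (a z : R) : R :=
  z / (1 + z) *
  (lambertW (a * (1 + z)) / (lambertW (a * (1 + z)) - lambertW a) ^+ 2).

Definition F1 (R : realType) (a z : R) : R :=
  z * lambertW (a / (1 + z)) / (lambertW a - lambertW (a / (1 + z))) ^+ 2.

Lemma lambertW_unique (R : realType) (x v w : R) :
  0 < v -> v * expR v = x -> 0 < w -> w * expR w = x -> v = w.
Proof.
have lt_mulexp (s t : R) : 0 < s -> s < t -> s * expR s < t * expR t.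
  by move=> s0 st; apply: ltr_pM; rewrite ?expR_ge0 ?ltr_expR ?ltW.
move=> v0 vx w0 wx; case: (ltgtP v w) => // h; exfalso.
- by have := lt_mulexp _ _ v0 h; rewrite vx wx ltxx.
- by have := lt_mulexp _ _ w0 h; rewrite vx wx ltxx.
Qed.

Lemma lambertW_spec (R : realType) (x : R) : 0 < x ->
  0 < lambertW x /\ lambertW x * expR (lambertW x) = x.
Proof.
move=> x0; suff [w ?] : exists w : R, 0 < w /\ w * expR w = x.
  by apply: (@xgetPex R 0 [set w : R | 0 < w /\ w * expR w = x]); exists w.
have cf : {within `[0, x], continuous (fun w : R => w * expR w)}.
  apply: continuous_subspaceT => w.
  by apply: cvgM; [exact: cvg_id | exact: continuous_expR].
have xe : x <= x * expR x.
  by apply: ler_peMr; [exact: ltW | rewrite -expR0 ler_expR ltW].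
have [|w /[!in_itv]/= /andP[w0 _] wx] := @IVT R _ 0 x x (ltW x0) cf.
  by rewrite mul0r ge_min le_max xe orbT ltW.
exists w; split => //; rewrite lt_neqAle w0 andbT; apply/eqP => w0'.
by move: wx x0; rewrite -w0' mul0r => <-; rewrite ltxx.
Qed.

Lemma lambertW_gt0 (R : realType) (x : R) : 0 < x -> 0 < lambertW x.
Proof. by case/lambertW_spec. Qed.

Lemma lambertW_expR (R : realType) (x : R) : 0 < x ->
  lambertW x * expR (lambertW x) = x.
Proof. by case/lambertW_spec. Qed.

(* Main.v *)
From HB Require Import structures.
Require Import Defs.
From mathcomp Require Import all_boot all_order all_algebra.
From mathcomp Require Import all_classical all_reals all_analysis.
From mathcomp Require Import measurable_realfun complex ring lra.

(** Put [p = W(a)]; then [a = p e^p] and the bound on [a] says that [p <= 1].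
With [q = W(a (1 + z))] one finds [F0 a z = Phi p q], and with
[q = W(a / (1 + z))] one finds [F1 a z = - Phi p q], where
[Phi p q = (q - p e^(p - q)) / (q - p)^2].  Hence a single integral
representation of [Phi p q], valid for every [q >= 0] other than [p], settles
both functions.

When [v] runs through [(0, pi)], the point [w = - v cot v + i v] runs through
the boundary values of [W] on the upper side of its cut, and there
[w e^w = - s] with [s = height v > 0].  Cauchy's formula for [F0] in the cut
plane, written in the variable [w], is [spectral_integral]: the integral over
[(0, pi)] of [density p v * (s + p e^p) / (s + q e^q)] equals
[pi (Phi p q - (1 + p)^2 / (q e^(q - p) - p))], the subtracted term coming from
the pole of [F0] at [z = 0].  Positivity is explicit: [density p v] is
[|1 + w|^2 (|w|^2 - p^2) / |w - p|^4], and [|w| = v / sin v >= 1 >= p].  So the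
representing measure of [F0] is a point mass at [0] plus the image under
[v |-> 1 + s / a] of a measure with positive density, and the one of [F1] is
obtained by the change of variable [z |-> - z / (1 + z)]; its constant term is
fixed by taking [q = 0] in the same identity.

The identity itself is a residue computation.  Its integrand is the imaginary
part of [b(w) ((1 + q) / (w - q) - (1 + p) / (w - p)) w' / (q - p)], up to sign,
where [b] ([ratio] below) is analytic in the strip [0 < Im w < pi] and extends
continuously to the real points [p] and [q].  For [k = p] and [k = q] separately,
the integral of [Im (b(w) w' / (w - k))] is [- pi b(k)] ([half_residue]).  To see
this, shrink the curve towards [k] by [w |-> k + r (w - k)], with [r] decreasing
from 1 to 0.  The derivative of the integral with respect to [r] is a difference
of values of [Im b / r] at the two ends, and an estimate
[|Im b(w)| <= B Im w / (2 + Re w)^2] ([ratio_bounds]) makes the total change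
negligible when the ends approach [v = 0] and [v = pi].  As [r] tends to 0 the
integral tends to [b(k)] times that of [Im (w' / (w - k))], the variation of an
argument, which is [- pi].  The computation is done on compact subintervals of
[(0, pi)], where no singularity occurs; the integrand of the identity being
positive, monotone convergence then gives the integral over [(0, pi)]. *)

Set Implicit Arguments.
Unset Strict Implicit.
Unset Printing Implicit Defensive.

Import Order.TTheory GRing.Theory Num.Theory.
Import numFieldNormedType.Exports.

Local Open Scope classical_set_scope.
Local Open Scope ring_scope.
Local Open Scope complex_scope.

(** * Calculus of complex-valued functions of a real variable *)

Section ComplexCalculus.
Variable R : realType.
Implicit Types (z w : R[i]) (f g : R -> R[i]) (x : R).
Local Notation re := (@complex.Re R).
Local Notation im := (@complex.Im R).

Lemma Re_mul z w : re (z * w) = re z * re w - im z * im w.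
Proof. by case: z w => [a b] [c d]. Qed.
Lemma Im_mul z w : im (z * w) = re z * im w + im z * re w.
Proof. by case: z w => [a b] [c d]. Qed.
Lemma Re_inv z : re z^-1 = re z / (re z ^+ 2 + im z ^+ 2).
Proof. by case: z. Qed.
Lemma Im_inv z : im z^-1 = - (im z / (re z ^+ 2 + im z ^+ 2)).
Proof. by case: z => a b /=; rewrite ?mulNr. Qed.
Lemma Re_add z w : re (z + w) = re z + re w.
Proof. by case: z w => [a b] [c d]. Qed.
Lemma Im_add z w : im (z + w) = im z + im w.
Proof. by case: z w => [a b] [c d]. Qed.
Lemma Re_opp z : re (- z) = - re z.
Proof. by case: z. Qed.
Lemma Im_opp z : im (- z) = - im z.
Proof. by case: z. Qed.
Definition ReImE := (Re_mul, Im_mul, Re_add, Im_add, Re_opp, Im_opp).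

Lemma Re_scale (r : R) z : re (r%:C * z) = r * re z.
Proof. by rewrite Re_mul /= mul0r subr0. Qed.
Lemma Im_scale (r : R) z : im (r%:C * z) = r * im z.
Proof. by rewrite Im_mul /= mul0r addr0. Qed.

Lemma Re_div z w : re (z / w) = (re z * re w + im z * im w) / (re w ^+ 2 + im w ^+ 2).
Proof. by rewrite Re_mul Re_inv Im_inv mulrN opprK mulrDl !mulrA. Qed.
Lemma Im_div z w : im (z / w) = (im z * re w - re z * im w) / (re w ^+ 2 + im w ^+ 2).
Proof. by rewrite Im_mul Re_inv Im_inv mulrN mulrBl !mulrA addrC. Qed.

Lemma complexD (a b : R) : (a + b)%:C = a%:C + b%:C.
Proof. by apply/eqP; rewrite eq_complex /= addr0 !eqxx. Qed.
Lemma complexN (a : R) : (- a)%:C = - a%:C.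
Proof. by apply/eqP; rewrite eq_complex /= oppr0 !eqxx. Qed.
Lemma complexM (a b : R) : (a * b)%:C = a%:C * b%:C.
Proof. by apply/eqP; rewrite eq_complex /= !mulr0 !mul0r subr0 addr0 !eqxx. Qed.
Lemma complexV (a : R) : (a^-1)%:C = (a%:C)^-1.
Proof. exact: (fmorphV (real_complex R)). Qed.
Lemma complex1 : (1 : R)%:C = 1. Proof. by []. Qed.
Definition complexE := (complexD, complexN, complexM, complexV, complex1).

Lemma normsq_gt0 z : z != 0 -> 0 < re z ^+ 2 + im z ^+ 2.
Proof.
case: z => a b; rewrite eq_complex negb_and /= => /orP[h|h].
  by rewrite ltr_pwDl ?sqr_ge0// exprn_even_gt0.
by rewrite ltr_wpDl ?sqr_ge0// exprn_even_gt0.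
Qed.

Lemma neq0_im z : im z != 0 -> z != 0.
Proof. by apply: contraNneq => ->. Qed.

Definition cexp z : R[i] :=
  (expR (re z) * cos (im z)) +i* (expR (re z) * sin (im z)).

(** Differentiability of a complex-valued function of a real variable is
expressed on the two components, which makes all the real calculus available. *)
Definition is_cderive f x (d : R[i]) :=
  is_derive x 1 (fun t => re (f t)) (re d) /\
  is_derive x 1 (fun t => im (f t)) (im d).

Definition ccontinuous (T : topologicalType) (f : T -> R[i]) (t : T) :=
  {for t, continuous (fun s => re (f s))} /\
  {for t, continuous (fun s => im (f s))}.

Lemma is_cderive_continuous f x d : is_cderive f x d -> ccontinuous f x.
Proof.
move=> [h1 h2]; split; apply/differentiable_continuous/derivable1_diffP;
 [exact: (@ex_derive _ _ _ _ _ _ _ h1)|exact: (@ex_derive _ _ _ _ _ _ _ h2)].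
Qed.

Lemma is_cderive_eq f x d d' : is_cderive f x d -> d = d' -> is_cderive f x d'.
Proof. by move=> h <-. Qed.

Lemma is_cderive_cst z x : is_cderive (fun=> z) x 0.
Proof. by split; exact: is_derive_cst. Qed.

Lemma is_cderiveD f g x d e : is_cderive f x d -> is_cderive g x e ->
  is_cderive (fun t => f t + g t) x (d + e).
Proof.
move=> [f1 f2] [g1 g2]; split.
- rewrite (_ : (fun _ => _) = (fun t => re (f t)) + (fun t => re (g t))).
    by rewrite Re_add; exact: is_deriveD.
  by apply/funext => t; rewrite Re_add.
- rewrite (_ : (fun _ => _) = (fun t => im (f t)) + (fun t => im (g t))).
    by rewrite Im_add; exact: is_deriveD.
  by apply/funext => t; rewrite Im_add.
Qed.

Lemma is_cderiveN f x d : is_cderive f x d -> is_cderive (fun t => - f t) x (- d).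
Proof.
move=> [f1 f2]; split.
- rewrite (_ : (fun _ => _) = - (fun t => re (f t))).
    by rewrite Re_opp; exact: is_deriveN.
  by apply/funext => t; rewrite Re_opp.
- rewrite (_ : (fun _ => _) = - (fun t => im (f t))).
    by rewrite Im_opp; exact: is_deriveN.
  by apply/funext => t; rewrite Im_opp.
Qed.

Lemma is_cderiveM f g x d e : is_cderive f x d -> is_cderive g x e ->
  is_cderive (fun t => f t * g t) x (d * g x + f x * e).
Proof.
move=> [f1 f2] [g1 g2]; split.
- rewrite (_ : (fun _ => _) = (fun t => re (f t)) * (fun t => re (g t))
     - (fun t => im (f t)) * (fun t => im (g t))); last first.
    by apply/funext => t; rewrite Re_mul.
  apply: (is_derive_eq (is_deriveB (is_deriveM f1 g1) (is_deriveM f2 g2))).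
  rewrite !ReImE /GRing.scale/=.
  by move: (re (f x)) (im (f x)) (re (g x)) (im (g x)) (re d) (im d) (re e) (im e) => *; ring.
- rewrite (_ : (fun _ => _) = (fun t => re (f t)) * (fun t => im (g t))
     + (fun t => im (f t)) * (fun t => re (g t))); last first.
    by apply/funext => t; rewrite Im_mul.
  apply: (is_derive_eq (is_deriveD (is_deriveM f1 g2) (is_deriveM f2 g1))).
  rewrite !ReImE /GRing.scale/=.
  by move: (re (f x)) (im (f x)) (re (g x)) (im (g x)) (re d) (im d) (re e) (im e) => *; ring.
Qed.

Lemma is_cderiveV f x d : f x != 0 -> is_cderive f x d ->
  is_cderive (fun t => (f t)^-1) x (- d / f x ^+ 2).
Proof.
move=> fx0 [f1 f2].
have n0 := normsq_gt0 fx0.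
set n := (fun t => re (f t)) ^+ 2 + (fun t => im (f t)) ^+ 2.
have nx : n x != 0 by rewrite /n fctE /= gt_eqF.
have nE t : n t = re (f t) ^+ 2 + im (f t) ^+ 2 by [].
have dn : is_derive x 1 n (2 * (re (f x) * re d + im (f x) * im d)).
  by apply: (is_derive_eq (is_deriveD (is_deriveX 2 f1) (is_deriveX 2 f2))); rewrite /GRing.scale/= expr1; ring.
have dnV := is_deriveV nx dn.
have nxE := nE x; clearbody n.
split.
- rewrite (_ : (fun _ => _) = (fun t => re (f t)) * (fun t => (n t)^-1)); last first.
    by apply/funext => t; rewrite Re_inv -nE.
  apply: (is_derive_eq (is_deriveM f1 dnV)).
  rewrite /GRing.scale /= expr2 !ReImE Re_inv Im_inv !ReImE nxE.
  move: nx n0; rewrite nxE; move: (re (f x)) (im (f x)) (re d) (im d) => a b u v n1 n2.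
  field; rewrite -?expr2 ?n1 ?andbT /=.
  by rewrite (_ : _ + _ = (a ^+ 2 + b ^+ 2) ^+ 2) ?expf_neq0//; ring.
- rewrite (_ : (fun _ => _) = - ((fun t => im (f t)) * (fun t => (n t)^-1))); last first.
    by apply/funext => t; rewrite Im_inv -nE.
  apply: (is_derive_eq (is_deriveN (is_deriveM f2 dnV))).
  rewrite /GRing.scale /= expr2 !ReImE Re_inv Im_inv !ReImE nxE.
  move: nx n0; rewrite nxE; move: (re (f x)) (im (f x)) (re d) (im d) => a b u v n1 n2.
  field; rewrite -?expr2 ?n1 ?andbT /=.
  by rewrite (_ : _ + _ = (a ^+ 2 + b ^+ 2) ^+ 2) ?expf_neq0//; ring.
Qed.

Lemma is_cderive_cexp f x d : is_cderive f x d ->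
  is_cderive (fun t => cexp (f t)) x (cexp (f x) * d).
Proof.
move=> [f1 f2].
have e1 := is_derive1_comp (is_derive_expR (re (f x))) f1.
have e2 := is_derive1_comp (is_derive_cos (im (f x))) f2.
have e3 := is_derive1_comp (is_derive_sin (im (f x))) f2.
split.
- rewrite (_ : (fun _ => _) = (expR \o (fun t => re (f t))) * (cos \o (fun t => im (f t)))) //.
  by apply: (is_derive_eq (is_deriveM e1 e2)); rewrite /GRing.scale/= Re_mul /=; ring.
- rewrite (_ : (fun _ => _) = (expR \o (fun t => re (f t))) * (sin \o (fun t => im (f t)))) //.
  by apply: (is_derive_eq (is_deriveM e1 e3)); rewrite /GRing.scale/= Im_mul /=; ring.
Qed.

Section Continuity.
Variables (T : topologicalType) (t : T).
Implicit Types F G : T -> R[i].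

Lemma ccontinuous_cst z : ccontinuous (fun=> z) t.
Proof. by split; exact: cvg_cst. Qed.

Lemma ccontinuousD F G : ccontinuous F t -> ccontinuous G t ->
  ccontinuous (fun s => F s + G s) t.
Proof.
move=> [f1 f2] [g1 g2]; split.
  rewrite (_ : (fun _ => _) = (fun s => re (F s) + re (G s))); first exact: cvgD.
  by apply/funext => s; rewrite Re_add.
rewrite (_ : (fun _ => _) = (fun s => im (F s) + im (G s))); first exact: cvgD.
by apply/funext => s; rewrite Im_add.
Qed.

Lemma ccontinuousN F : ccontinuous F t -> ccontinuous (fun s => - F s) t.
Proof.
move=> [f1 f2]; split.
  rewrite (_ : (fun _ => _) = (fun s => - re (F s))); first exact: cvgN.
  by apply/funext => s; rewrite Re_opp.
rewrite (_ : (fun _ => _) = (fun s => - im (F s))); first exact: cvgN.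
by apply/funext => s; rewrite Im_opp.
Qed.

Lemma ccontinuousM F G : ccontinuous F t -> ccontinuous G t ->
  ccontinuous (fun s => F s * G s) t.
Proof.
move=> [f1 f2] [g1 g2]; split.
  rewrite (_ : (fun _ => _) = (fun s => re (F s) * re (G s) - im (F s) * im (G s))).
    by apply: cvgB; exact: cvgM.
  by apply/funext => s; rewrite Re_mul.
rewrite (_ : (fun _ => _) = (fun s => re (F s) * im (G s) + im (F s) * re (G s))).
  by apply: cvgD; exact: cvgM.
by apply/funext => s; rewrite Im_mul.
Qed.

Lemma ccontinuousV F : F t != 0 -> ccontinuous F t ->
  ccontinuous (fun s => (F s)^-1) t.
Proof.
move=> F0 [f1 f2]; have n0 := normsq_gt0 F0.
have cn : {for t, continuous (fun s => (re (F s) ^+ 2 + im (F s) ^+ 2)^-1)}.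
  apply: cvgV; first by rewrite gt_eqF.
  by under eq_fun do rewrite 2!expr2; apply: cvgD; exact: cvgM.
split.
  rewrite (_ : (fun _ => _) = (fun s => re (F s) * (re (F s) ^+ 2 + im (F s) ^+ 2)^-1)).
    exact: cvgM.
  by apply/funext => s; rewrite Re_inv.
rewrite (_ : (fun _ => _) = (fun s => - (im (F s) * (re (F s) ^+ 2 + im (F s) ^+ 2)^-1))).
  by apply: cvgN; exact: cvgM.
by apply/funext => s; rewrite Im_inv.
Qed.

Lemma ccontinuous_cexp F : ccontinuous F t -> ccontinuous (fun s => cexp (F s)) t.
Proof.
move=> [f1 f2]; split => /=; apply: cvgM.
- by apply: (@cvg_comp _ _ _ _ expR _ _ _ f1); exact: continuous_expR.
- by apply: (@cvg_comp _ _ _ _ cos _ _ _ f2); exact: continuous_cos.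
- by apply: (@cvg_comp _ _ _ _ expR _ _ _ f1); exact: continuous_expR.
- by apply: (@cvg_comp _ _ _ _ sin _ _ _ f2); exact: continuous_sin.
Qed.

End Continuity.
End ComplexCalculus.

(** * Shrinking a curve towards a real pole *)

Section HalfResidue.
Variable R : realType.
Local Notation re := (@complex.Re R).
Local Notation im := (@complex.Im R).
Local Notation mu := (@lebesgue_measure R).

Lemma FTC_closed (f F : R -> R) (a b : R) : a < b ->
  (forall x, a <= x <= b -> is_derive x 1 F (f x)) ->
  (forall x, a <= x <= b -> {for x, continuous f}) ->
  \int[mu]_(x in `[a, b]) f x = F b - F a.
Proof.
move=> ab dF cf.
have cF x : a <= x <= b -> {for x, continuous F}.
  by move=> /dF[d _]; exact/differentiable_continuous/derivable1_diffP.
rewrite /Rintegral (@continuous_FTC2 _ f F) //.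
- apply: continuous_in_subspaceT => x; rewrite inE/= in_itv/=; exact: cf.
- split.
  + by move=> x; rewrite in_itv/= => /andP[/ltW ax /ltW xb]; have [] := dF x; rewrite ?ax.
  + by apply: cvg_at_right_filter; apply: cF; rewrite lexx ltW.
  + by apply: cvg_at_left_filter; apply: cF; rewrite lexx ltW.
- move=> x; rewrite in_itv/= => /andP[/ltW ax /ltW xb].
  by rewrite derive1E; apply: (@derive_val _ _ _ _ _ _ _ (dF x _)); rewrite ax.
Qed.

Lemma integrable_closed (f : R -> R) (a b : R) :
  (forall x, a <= x <= b -> {for x, continuous f}) ->
  mu.-integrable `[a, b] (EFin \o f).
Proof.
move=> cf; apply: continuous_compact_integrable; first exact: segment_compact.
by apply: continuous_in_subspaceT => x; rewrite inE/= in_itv/=; exact: cf.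
Qed.

Variables (k : R) (b b' : R[i] -> R[i]) (c dc : R -> R).
Hypothesis b_deriv : forall (f : R -> R[i]) x d, 0 < im (f x) < pi ->
  is_cderive f x d -> is_cderive (fun t => b (f t)) x (b' (f x) * d).
Hypothesis b'_cont : forall (T : topologicalType) (f : T -> R[i]) t,
  0 < im (f t) < pi -> ccontinuous f t -> ccontinuous (fun s => b' (f s)) t.
Hypothesis c_deriv : forall v : R, 0 < v < pi -> is_derive v 1 c (dc v).
Hypothesis dc_cont : forall v : R, 0 < v < pi -> {for v, continuous dc}.

(** The curve under study is [v |-> c v + i v]; [chord v] joins [k] to its point
of parameter [v], and [scaled r v] lies on that chord at ratio [r]. *)
Definition chord (v : R) : R[i] := (c v - k) +i* v.
Definition scaled (r v : R) : R[i] := k%:C + r%:C * chord v.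
Definition tangent (v : R) : R[i] := dc v +i* 1.

Lemma Re_scaled r v : re (scaled r v) = k + r * (c v - k).
Proof. by rewrite /scaled/= !mul0r subr0. Qed.
Lemma Im_scaled r v : im (scaled r v) = r * v.
Proof. by rewrite /scaled/= !mul0r add0r addr0. Qed.

Lemma c_cont v : 0 < v < pi -> {for v, continuous c}.
Proof. by move=> /c_deriv[d _]; exact/differentiable_continuous/derivable1_diffP. Qed.

Lemma chord_deriv v : 0 < v < pi -> is_cderive chord v (tangent v).
Proof.
move=> v0; split => /=; last exact: is_derive_id.
rewrite -[dc v]subr0; exact: (is_deriveB (c_deriv v0) (is_derive_cst _ _ _)).
Qed.

Lemma tangent_cont v : 0 < v < pi -> ccontinuous tangent v.
Proof. by move=> v0; split => /=; [exact: dc_cont|exact: cvg_cst]. Qed.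

Lemma scaled_deriv_l r v : is_cderive (fun t => scaled t v) r (chord v).
Proof.
split.
  under eq_fun do rewrite Re_scaled.
  rewrite (_ : (fun _ => _) = cst k + (re (chord v)) \*: id); last first.
    by apply/funext => t /=; rewrite fctE /= /GRing.scale/= mulrC.
  by apply: is_derive_eq; rewrite /GRing.scale/= mulr1 add0r.
under eq_fun do rewrite Im_scaled.
rewrite (_ : (fun _ => _) = v \*: id); last first.
  by apply/funext => t /=; rewrite /GRing.scale/= mulrC.
by apply: is_derive_eq; rewrite /GRing.scale/= mulr1.
Qed.

Lemma scaled_deriv_r r v : 0 < v < pi ->
  is_cderive (scaled r) v (r%:C * tangent v).
Proof.
move=> v0; apply: (is_cderive_eq (is_cderiveD (is_cderive_cst _ _)
  (is_cderiveM (is_cderive_cst _ _) (chord_deriv v0)))).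
by rewrite mul0r !add0r.
Qed.

Lemma scaled_cont2 (x : R * R) : 0 < x.2 < pi ->
  ccontinuous (fun x : R * R => scaled x.1 x.2) x.
Proof.
move=> v0; split.
  rewrite (_ : (fun _ => _) = (fun s : R * R => k + s.1 * (c s.2 - k))); last first.
    by apply/funext => s; rewrite Re_scaled.
  apply: cvgD; first exact: cvg_cst.
  apply: cvgM; first exact: cvg_fst.
  apply: cvgB; last exact: cvg_cst.
  by apply: (@cvg_comp _ _ _ snd c _ _ _ cvg_snd); exact: c_cont.
rewrite (_ : (fun _ => _) = (fun s : R * R => s.1 * s.2)); last first.
  by apply/funext => s; rewrite Im_scaled.
by apply: cvgM; [exact: cvg_fst|exact: cvg_snd].
Qed.

Lemma chord_neq0 v : 0 < v -> chord v != 0.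
Proof. by move=> v0; apply: neq0_im; rewrite /= gt_eqF. Qed.

Definition integrand (r v : R) : R := im (b (scaled r v) * (tangent v / chord v)).

Lemma scaled_im r v V : 0 < v <= V -> 0 < r -> r * V < pi ->
  0 < im (scaled r v) < pi.
Proof.
move=> /andP[v0 vV] r0 rV; rewrite Im_scaled mulr_gt0//=.
by rewrite (le_lt_trans _ rV)// ler_pM2l.
Qed.

Section Truncated.
Variables (d V : R).
Hypotheses (d0 : 0 < d) (dV : d < V) (Vpi : V < pi).

Let in_pi v : d <= v <= V -> 0 < v < pi.
Proof.
by move=> /andP[dv vV]; rewrite (lt_le_trans d0 dv) (le_lt_trans vV Vpi).
Qed.
Let in_V v : d <= v <= V -> 0 < v <= V.
Proof. by move=> /andP[dv vV]; rewrite (lt_le_trans d0 dv). Qed.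

Lemma tangent_chord_cont v : d <= v <= V ->
  ccontinuous (fun v => tangent v / chord v) v.
Proof.
move=> dvV; have v0 := in_pi dvV; apply: ccontinuousM; first exact: tangent_cont.
apply: ccontinuousV; first by apply: chord_neq0; case/andP: v0.
exact: is_cderive_continuous (chord_deriv v0).
Qed.

Lemma integrand_cont r v : 0 < r -> r * V < pi -> d <= v <= V ->
  {for v, continuous (integrand r)}.
Proof.
move=> r0 rV dvV.
suff : ccontinuous (fun v => b (scaled r v) * (tangent v / chord v)) v by case.
apply: ccontinuousM; last exact: tangent_chord_cont.
apply: is_cderive_continuous; apply: b_deriv.
  exact: (scaled_im (in_V dvV)).
exact: (scaled_deriv_r _ (in_pi dvV)).
Qed.

Definition scaled_integral (r : R) := \int[mu]_(v in `[d, V]) integrand r v.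

Lemma integrand_deriv r v : 0 < r -> r * V < pi -> d <= v <= V ->
  is_derive r 1 (integrand ^~ v) (im (b' (scaled r v) * tangent v)).
Proof.
move=> r0 rV dvV.
have h := b_deriv (f := fun t => scaled t v) (scaled_im (in_V dvV) r0 rV)
  (scaled_deriv_l r v).
have [_ cut_hi] := is_cderiveM h (is_cderive_cst (tangent v / chord v) r).
apply: (is_derive_eq cut_hi); congr im.
have c0 : chord v != 0 by apply: chord_neq0; case/andP: (in_pi dvV).
by field.
Qed.

(** Continuity on a compact rectangle provides the domination needed to
differentiate under the integral sign. *)
Lemma integrand_deriv_bounded r1 r2 : 0 < r1 -> r1 < r2 -> r2 * V < pi ->
  exists M, 0 <= M /\ forall r v, r1 <= r <= r2 -> d <= v <= V ->
    `|im (b' (scaled r v) * tangent v)| <= M.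
Proof.
move=> r10 r12 r2V.
pose g (x : R * R) : R := `|im (b' (scaled x.1 x.2) * tangent x.2)|.
have cg : {within `[r1, r2]%classic `*` `[d, V]%classic, continuous g}.
  apply: continuous_in_subspaceT => -[r v]; rewrite inE => -[] /=.
  rewrite !in_itv/= => /andP[rr1 rr2] dvV.
  have r0 := lt_le_trans r10 rr1.
  have rV : r * V < pi.
    by rewrite (le_lt_trans _ r2V)// ler_pM2r// (lt_trans d0).
  apply: cvg_norm.
  suff : ccontinuous (fun x : R * R => b' (scaled x.1 x.2) * tangent x.2) (r, v) by case.
  apply: ccontinuousM.
    apply: (b'_cont (f := fun x : R * R => scaled x.1 x.2)) => /=.
      exact: (scaled_im (in_V dvV)).
    by apply: scaled_cont2; exact: in_pi.
  have [t1 t2] := tangent_cont (in_pi dvV).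
  split; last exact: cvg_cst.
  by apply: (@cvg_comp _ _ _ snd dc _ _ _ cvg_snd); exact: dc_cont (in_pi dvV).
have [|[r v] _ gmax] := compact_EVT_max _ (compact_setX
    (@segment_compact R r1 r2) (@segment_compact R d V)) cg.
  by exists (r1, d); split => /=; rewrite in_itv/= lexx ltW.
exists (g (r, v)); split; first by rewrite /g normr_ge0.
move=> r' v' h1 h2; have := gmax (r', v'); rewrite /g/=; apply.
by rewrite inE; split => /=; rewrite in_itv.
Qed.

(** Cauchy's theorem in differential form.  By analyticity the derivative of the
integrand with respect to [r] is [Im (b'(k + r y) y')], with [y] the chord, and
this is also [1 / r] times the derivative of [Im b(k + r y)] with respect to
[v].  So only the two ends contribute. *)
Lemma scaled_integral_deriv (r : R) : 0 < r <= 1 -> is_derive r 1 scaled_integral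
  (r^-1 * (im (b (scaled r V)) - im (b (scaled r d)))).
Proof.
move=> /andP[r0 r1].
have V0 : 0 < V by exact: lt_trans dV.
(* midway between 1 and pi / V, so that the scaled curve stays in the strip *)
pose r2 := (1 + pi / V) / 2.
have piV : 1 < pi / V by rewrite ltr_pdivlMr// mul1r.
have rr2 : r < r2 by rewrite (le_lt_trans r1)// /r2; lra.
have r2V : r2 * V < pi.
  rewrite /r2 mulrAC mulrDl mul1r divfK ?gt_eqF//.
  by rewrite ltr_pdivrMr// mulr_natr mulr2n ltrD2r.
have rh0 : 0 < r / 2 by rewrite divr_gt0.
have hr : r / 2 < r by rewrite ltr_pdivrMr// ltr_pMr// ltr1n.
have [M [M0 MP]] := integrand_deriv_bounded rh0 (lt_trans hr rr2) r2V.
have mD : measurable (`[d, V] : set R) by exact: measurable_itv.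
have Ir : `]r / 2, r2[%classic r by rewrite /= in_itv/= hr rr2.
have sub t : `]r / 2, r2[%classic t -> [/\ 0 < t, t * V < pi & r / 2 <= t <= r2].
  rewrite /= in_itv/= => /andP[t1 t2]; split; first exact: lt_trans t1.
    by rewrite (lt_trans _ r2V)// ltr_pM2r.
  by rewrite !ltW.
have intf t : `]r / 2, r2[%classic t -> mu.-integrable `[d, V] (EFin \o integrand t).
  move=> /sub[t0 tV _]; apply: integrable_closed => v; exact: integrand_cont.
have der t v : `]r / 2, r2[%classic t -> `[d, V]%classic v ->
    derivable (integrand ^~ v) t 1.
  move=> /sub[t0 tV _]; rewrite /= in_itv/= => dv.
  by have [] := integrand_deriv t0 tV dv.
have partialE t v : `]r / 2, r2[%classic t -> `[d, V]%classic v ->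
    partial1of2 integrand t v = im (b' (scaled t v) * tangent v).
  move=> /sub[t0 tV _]; rewrite /= in_itv/= => dv.
  by rewrite partial1of2E; exact: (@derive_val _ _ _ _ _ _ _ (integrand_deriv t0 tV dv)).
have intG : mu.-integrable `[d, V] (EFin \o (cst M : R -> R)).
  by apply: integrable_closed => v _; exact: cvg_cst.
have ub t v : `]r / 2, r2[%classic t -> `[d, V]%classic v ->
    `|partial1of2 integrand t v| <= cst M v.
  move=> tI vI; rewrite partialE//; have [_ _ t2] := sub _ tI.
  by apply: MP => //; move: vI; rewrite /= in_itv.
apply: DeriveDef.
  exact (@derivable_under_integral R _ _ mu integrand _ mD _ _ _ Ir intf der (cst M) (fun=> M0) intG ub).
rewrite -derive1E.
rewrite (@differentiation_under_integral R _ _ mu integrand _ mD _ _ _ Ir intf der (cst M) (fun=> M0) intG ub).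
rewrite (@eq_Rintegral _ _ _ mu _ (fun v => im (b' (scaled r v) * tangent v))); last first.
  by move=> v /[!inE] vI; rewrite partialE.
have [rp rV _] := sub _ Ir.
have dF v : d <= v <= V -> is_derive v 1 (fun v => r^-1 * im (b (scaled r v)))
    (im (b' (scaled r v) * tangent v)).
  move=> dv.
  have [_ h] := b_deriv (scaled_im (in_V dv) rp rV) (scaled_deriv_r r (in_pi dv)).
  rewrite (_ : (fun _ => _) = r^-1 \*: (fun t => im (b (scaled r t)))) //.
  apply: (is_derive_eq (is_deriveZ _ h)).
  rewrite mulrCA; set z := b' _ * _.
  have -> : im (r%:C * z) = r * im z by rewrite Im_mul /= mul0r addr0.
  by rewrite /GRing.scale/= mulrA mulVf ?gt_eqF// mul1r.
have cf v : d <= v <= V -> {for v, continuous (fun v => im (b' (scaled r v) * tangent v))}.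
  move=> dv.
  suff : ccontinuous (fun v => b' (scaled r v) * tangent v) v by case.
  apply: ccontinuousM; last exact: tangent_cont (in_pi dv).
  apply: b'_cont; first exact: (scaled_im (in_V dv)).
  exact: is_cderive_continuous (scaled_deriv_r r (in_pi dv)).
by rewrite (FTC_closed dV dF cf) mulrBr.
Qed.

Variable B : R.
Hypothesis B_ge0 : 0 <= B.
Hypothesis b_im : forall w, 0 < im w < pi -> -1 <= re w ->
  `|im (b w)| <= B * im w / (2 + re w) ^+ 2.
Hypothesis c_ge : forall v : R, 0 < v < pi -> -1 <= c v.
Hypothesis k_ge : -1 <= k.

Let re_scaled_ge (r v : R) : 0 < v < pi -> 0 <= r <= 1 -> -1 <= re (scaled r v).
Proof.
move=> v0 /andP[r0 r1]; rewrite Re_scaled.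
have := c_ge v0; move: (c v) k_ge => x; nra.
Qed.

(** Along the chord ending at parameter [d], [Im b / r] is at most [B d]; along the
one ending at [V], which goes far to the right, the quadratic
decay of [Im b] makes its integral over [r] at most [B pi / (c V - k)]. *)
Lemma scaled_integral_change (r : R) : 0 < r <= 1 -> 0 < c V - k ->
  `|scaled_integral 1 - scaled_integral r| <= B * d + B * pi / (c V - k).
Proof.
move=> /andP[r0 r1] C0; set C := c V - k in C0 *.
have V0 : 0 < V by exact: lt_trans dV.
have in_piV : 0 < V < pi by rewrite V0.
have in_pid : 0 < d < pi by rewrite d0 (lt_trans dV).
pose D t := 2 + k + t * C.
have D1 (t : R) : 0 <= t -> 1 <= D t.
  by move=> t0; rewrite /D; have := mulr_ge0 t0 (ltW C0); move: k_ge; lra.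
(* a primitive of the bound on the derivative of the integral *)
pose P t := B * d * t - B * V / C * (D t)^-1.
have dP (t : R) : 0 <= t -> is_derive t 1 P (B * d + B * V / (D t) ^+ 2).
  move=> t0; have Dt0 : D t != 0 by rewrite gt_eqF// (lt_le_trans ltr01)// D1.
  have dD : is_derive t 1 D C.
    rewrite (_ : D = cst (2 + k) + C \*: id); last first.
      by apply/funext => s /=; rewrite /D fctE/= /GRing.scale/= mulrC.
    apply: (is_derive_eq (is_deriveD (is_derive_cst _ _ _) (is_deriveZ C (is_derive_id t 1)))).
    by rewrite /GRing.scale/= mulr1 add0r.
  rewrite (_ : P = (B * d) \*: id - (B * V / C) \*: (fun t => (D t)^-1)) //.
  apply: (is_derive_eq (is_deriveB (is_deriveZ _ (is_derive_id t 1)) (is_deriveZ _ (is_deriveV Dt0 dD)))).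
  rewrite /GRing.scale/=; move: C0 Dt0; move: (D t) => x C0 Dt0.
  by field; rewrite Dt0 gt_eqF.
have bd (t : R) : 0 < t < 1 -> `|t^-1 * (im (b (scaled t V)) - im (b (scaled t d)))|
    <= B * d + B * V / (D t) ^+ 2.
  move=> /andP[t0 t1].
  have t01 : 0 <= t <= 1 by rewrite !ltW.
  have tV : t * V < pi by rewrite (lt_trans _ Vpi)// gtr_pMl.
  have hV := b_im (scaled_im (v := V) (V := V) _ t0 tV) (re_scaled_ge in_piV t01).
  have hd := b_im (scaled_im (v := d) (V := V) _ t0 tV) (re_scaled_ge in_pid t01).
  rewrite normrM gtr0_norm ?invr_gt0// ler_pdivrMl//.
  rewrite (le_trans (ler_normB _ _))// addrC mulrDr lerD//.
    apply: (le_trans (hd _)); first by rewrite d0 ltW.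
    rewrite Im_scaled mulrCA ler_pdivrMr; last first.
      by rewrite exprn_gt0//; have := re_scaled_ge in_pid t01; lra.
    rewrite ler_peMr ?mulr_ge0 ?(ltW t0) ?(ltW d0)//.
    by rewrite expr_ge1//; have := re_scaled_ge in_pid t01; lra.
  apply: (le_trans (hV _)); first by rewrite V0 lexx.
  by rewrite Im_scaled Re_scaled mulrCA !mulrA [t * B]mulrC addrA lexx.
have mono (e : R) : `|e| <= 1 -> P r + e * scaled_integral r <= P 1 + e * scaled_integral 1.
  move=> e1; pose Pe t := P t + e * scaled_integral t; rewrite -/(Pe r) -/(Pe 1).
  have dd (t : R) : 0 < t <= 1 -> is_derive t 1 Pe (B * d + B * V / (D t) ^+ 2
     + e * (t^-1 * (im (b (scaled t V)) - im (b (scaled t d))))).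
    move=> t01; have /andP[/ltW t0 _] := t01.
    exact: (is_deriveD (dP t t0) (is_deriveZ e (scaled_integral_deriv t01))).
  clearbody Pe.
  apply: (@ger0_derive1_ndecr R Pe r 1 _ _ _ r 1 (lexx r) r1 (lexx 1)).
  - move=> t; rewrite in_itv/= => /andP[rt t1].
    by have [] := dd t; rewrite ?(ltW t1) ?(lt_trans r0 rt).
  - move=> t; rewrite in_itv/= => /andP[rt t1]; have t0 := lt_trans r0 rt.
    rewrite derive1E (@derive_val _ _ _ _ _ _ _ (dd t _)) ?t0 ?(ltW t1)//.
    have /bd : 0 < t < 1 by rewrite t0 t1.
    set Y := t^-1 * _; set X := B * d + _ => yb.
    have : `|e * Y| <= X by rewrite normrM (le_trans _ yb)// ler_piMl.
    by rewrite ler_norml => /andP[h _]; rewrite -lerBlDl sub0r.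
  - apply: continuous_in_subspaceT => t; rewrite inE/= in_itv/= => /andP[rt t1].
    have [h _] := dd t (introT andP (conj (lt_le_trans r0 rt) t1)).
    by apply/differentiable_continuous/derivable1_diffP.
have m1 := mono 1 _; have m2 := mono (-1) _.
have PP : P 1 - P r <= B * d + B * pi / C.
  rewrite /P; have := D1 _ ler01; have := D1 _ (ltW r0).
  move: (D 1) (D r) => x y y1 x1.
  have xV : 0 <= x^-1 by rewrite invr_ge0 (le_trans ler01).
  have yV : y^-1 <= 1 by rewrite invf_le1 ?(lt_le_trans ltr01).
  have h1 : 0 <= B * V / C * x^-1 by rewrite !mulr_ge0// ?invr_ge0 ltW.
  have h2 : B * V / C * y^-1 <= B * pi / C.
    apply: (@le_trans _ _ (B * V / C)).
      by rewrite ler_piMr// !mulr_ge0// ?invr_ge0 ltW.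
    by rewrite ler_wpM2r ?invr_ge0 ?(ltW C0)// ler_wpM2l// ltW.
  have h3 : B * d * (1 - r) <= B * d.
    by rewrite ler_piMr ?mulr_ge0// ?(ltW d0)// gerBl ltW.
  rewrite (_ : _ - _ = B * d * (1 - r) + B * V / C * y^-1 - B * V / C * x^-1).
    by rewrite lerBlDr -[leLHS]addr0 lerD// lerD.
  by move: (B * V / C) x^-1 y^-1 => *; ring.
rewrite ler_norml; apply/andP; split.
  by move: m1; rewrite normr1 => /(_ (lexx _)); move: PP; move: (P r) (P 1) (scaled_integral r) (scaled_integral 1) (B * d + _) => Pr P1 pr p1 E; lra.
by move: m2; rewrite normrN normr1 => /(_ (lexx _)); move: PP; move: (P r) (P 1) (scaled_integral r) (scaled_integral 1) (B * d + _) => Pr P1 pr p1 E; lra.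
Qed.

(** The argument of [chord V] minus that of [chord d]; in the upper half-plane the
argument is [pi / 2 - atan (Re / Im)]. *)
Definition angle := atan ((c d - k) / d) - atan ((c V - k) / V).

Lemma integral_angle :
  \int[mu]_(v in `[d, V]) im (tangent v / chord v) = angle.
Proof.
pose F v := - atan ((c v - k) / v).
have dF v : d <= v <= V -> is_derive v 1 F (im (tangent v / chord v)).
  move=> dvV; have /andP[v0 vpi] := in_pi dvV.
  have dc1 : is_derive v 1 (fun v => c v - k) (dc v - 0).
    exact: (is_deriveB (c_deriv (in_pi dvV)) (is_derive_cst _ _ _)).
  have vn0 : id v != 0 by rewrite gt_eqF.
  have dq := is_deriveM dc1 (is_deriveV vn0 (is_derive_id v 1)).
  have da := is_deriveN (is_derive1_comp (is_derive1_atan _) dq).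
  apply: (is_derive_eq da).
  rewrite Im_mul Re_inv Im_inv /= !fctE /= /GRing.scale/=.
  have h0 : (c v - k) ^+ 2 + v ^+ 2 != 0.
    by rewrite gt_eqF// ltr_wpDl ?sqr_ge0// exprn_gt0.
  move: h0 v0; move: (c v - k) (dc v) => x y h0 v0.
  by field; rewrite h0 gt_eqF.
rewrite (FTC_closed dV dF); first by rewrite /F /angle opprK addrC.
by move=> v dv; have [] := tangent_chord_cont dv.
Qed.

Variable beta : R.
Variable B' : R.
Hypothesis b_bound : forall w, 0 < im w < pi -> -1 <= re w ->
  `|re (b w)| <= B' /\ `|im (b w)| <= B'.
Hypothesis b_lim : forall v : R, 0 < v < pi ->
  (fun n => re (b (scaled n.+1%:R^-1 v))) @ \oo --> beta /\
  (fun n => im (b (scaled n.+1%:R^-1 v))) @ \oo --> 0.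

(** Only the value [beta] of [b] at [k] survives when the curve collapses to
[k], while [w' / (w - k)] does not depend on [r]. *)
Lemma scaled_integral_lim : scaled_integral n.+1%:R^-1 @[n --> \oo] --> beta * angle.
Proof.
have mD : measurable (`[d, V] : set R) by exact: measurable_itv.
have rn n : 0 < (n.+1%:R^-1 : R) <= 1.
  by rewrite invr_gt0 ltr0n/= invf_le1 ?ltr0n// ler1n.
have rnV n : n.+1%:R^-1 * V < pi.
  by have /andP[a1 a2] := rn n; rewrite (le_lt_trans _ Vpi)// ler_piMl// ltW// (lt_trans d0).
have kint r : 0 < r -> r * V < pi -> mu.-integrable `[d, V] (EFin \o integrand r).
  by move=> r0 rV; apply: integrable_closed => v; exact: integrand_cont.
have tcont v : d <= v <= V -> {for v, continuous (fun v => im (tangent v / chord v))}.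
  by move=> /tangent_chord_cont[].
pose q v := tangent v / chord v.
pose g v := B' * (`|re (q v)| + `|im (q v)|).
have gint : mu.-integrable `[d, V] (EFin \o g).
  apply: integrable_closed => v /tangent_chord_cont[c1 c2].
  by apply: cvgM; [exact: cvg_cst|apply: cvgD; exact: cvg_norm].
have tint : mu.-integrable `[d, V] (EFin \o (fun v => beta * im (q v))).
  apply: integrable_closed => v /tcont c1.
  by apply: cvgM; [exact: cvg_cst|exact: c1].
rewrite -integral_angle -RintegralZl//; last by apply: integrable_closed.
rewrite /scaled_integral /Rintegral.
apply: fine_cvg; rewrite fineK; last exact: integrable_fin_num.
apply: (@dominated_cvg _ _ _ mu `[d, V] mD (fun n v => (integrand n.+1%:R^-1 v)%:E)
   _ (EFin \o g)) => //.
- by move=> n; have /andP[r0 _] := rn n; exact: (measurable_int mu (kint _ r0 (rnV n))).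
- move=> v; rewrite /= in_itv/= => dvV; apply: cvg_EFin; first exact: nearW.
  have [l1 l2] := b_lim (in_pi dvV).
  rewrite /integrand -/(q v); under eq_fun do rewrite /comp Im_mul.
  rewrite -[beta * _]addr0 -[X in _ + X](mul0r (re (q v))).
  by apply: cvgD; apply: cvgMl.
- move=> n v; rewrite /= in_itv/= => dvV; rewrite lee_fin /integrand -/(q v) Im_mul.
  have /andP[r0 r1] := rn n.
  have [] := @b_bound (scaled n.+1%:R^-1 v).
  + exact: (scaled_im (in_V dvV)).
  + by apply: re_scaled_ge; [exact: in_pi dvV|rewrite ltW].
  move=> b1 b2; rewrite (le_trans (ler_normD _ _))// !normrM /g mulrDr addrC.
  by rewrite lerD// ler_wpM2r.
Qed.

Lemma half_residue_truncated : 0 < c V - k ->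
  `|scaled_integral 1 - beta * angle| <= B * d + B * pi / (c V - k).
Proof.
move=> C0; set E := B * d + _.
have := scaled_integral_lim; set u := (fun n => _) => ul.
have ul' : (fun n => `|scaled_integral 1 - u n|) @ \oo --> `|scaled_integral 1 - beta * angle|.
  by apply: cvg_norm; apply: cvgB => //; exact: cvg_cst.
rewrite -(cvg_lim _ ul')//; apply: limr_le; first by apply/cvg_ex; eexists; exact: ul'.
apply: nearW => n; apply: scaled_integral_change => //.
by rewrite invr_gt0 ltr0n/= invf_le1 ?ltr0n// ler1n.
Qed.

End Truncated.
End HalfResidue.

(** * Elementary inequalities *)

Section TrigBounds.
Variable R : realType.
Implicit Types x y : R.

(** A mean value inequality, used below for all the trigonometric bounds. *)
Lemma ndecr_of_derive (f f' : R -> R) (a b : R) : a <= b ->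
  (forall x : R, a <= x <= b -> is_derive x 1 f (f' x)) ->
  (forall x : R, a <= x <= b -> 0 <= f' x) -> f a <= f b.
Proof.
move=> ab df f0.
apply: (@ger0_derive1_ndecr R f a b _ _ _ a b (lexx a) ab (lexx b)).
- move=> x; rewrite in_itv/= => /andP[/ltW ax /ltW xb].
  by have [] := df x (introT andP (conj ax xb)).
- move=> x; rewrite in_itv/= => /andP[/ltW ax /ltW xb].
  have axb := introT andP (conj ax xb).
  by rewrite derive1E (@derive_val _ _ _ _ _ _ _ (df x axb)); exact: f0.
- apply: continuous_in_subspaceT => x; rewrite inE/= in_itv/= => axb.
  by have [h _] := df x axb; exact/differentiable_continuous/derivable1_diffP.
Qed.

Lemma sin_le_id y : 0 <= y -> sin y <= y.
Proof.
move=> y0.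
have := @ndecr_of_derive (fun t => t - sin t) (fun t => 1 - cos t) 0 y y0.
rewrite sin0 subrr subr_ge0; apply => t _.
by rewrite subr_ge0 cos_le1.
Qed.

Lemma cos_ge_sqr y : 0 <= y -> 1 - y ^+ 2 / 2 <= cos y.
Proof.
move=> y0.
have := @ndecr_of_derive (fun t => cos t + 2^-1 * (t ^+ 2)) (fun t => - sin t + t) 0 y y0.
rewrite cos0 expr0n/= mulr0 addr0 => h.
suff : 1 <= cos y + 2^-1 * y ^+ 2 by lra.
apply: h => t /andP[t0 _]; last by rewrite addrC subr_ge0 sin_le_id.
apply: (is_derive_eq (is_deriveD (is_derive_cos t)
  (is_deriveZ (2^-1) (is_deriveX 2 (is_derive_id t 1))))).
by rewrite /GRing.scale/= expr1 mulr1 mulrA mulVf ?mul1r// pnatr_eq0.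
Qed.

Lemma sin_ge_mul_cos y : 0 <= y <= pi -> y * cos y <= sin y.
Proof.
move=> /andP[y0 ypi].
have := @ndecr_of_derive (fun t => sin t - t * cos t) (fun t => t * sin t) 0 y y0.
rewrite sin0 mul0r subrr subr_ge0; apply => t /andP[t0 ty].
  apply: (is_derive_eq (is_deriveB (is_derive_sin t)
   (is_deriveM (is_derive_id t 1) (is_derive_cos t)))).
  by rewrite /GRing.scale/= mulr1; ring.
by rewrite mulr_ge0// sin_ge0_pi// t0 (le_trans ty).
Qed.

Lemma sin_ge_cube y : 0 <= y <= pi -> y - sin y <= y * (y ^+ 2 / 2).
Proof.
move=> h; have := sin_ge_mul_cos h; have /andP[y0 _] := h.
have := ler_wpM2l y0 (cos_ge_sqr y0); lra.
Qed.

Lemma pi_le4 : (pi : R) <= 4.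
Proof. by have [/andP[_ h] _] := @pihalf_02_cos_pihalf R; lra. Qed.

End TrigBounds.

Section EpsBounds.
Variable R : realType.
Variables (L : R).
Hypothesis L0 : 0 <= L.
Let K : R := expR L.

Let K1 : 1 <= K.
Proof. by rewrite /K -expR0 ler_expR. Qed.

(** All consequences of monotonicity and of [1 + t <= exp t] at [t = x] and
[t = - x]. *)
Lemma exp_facts (x : R) : - L <= x -> let E := expR (- x) in
  [/\ 0 < E, 1 - x <= E, (1 + x) * E <= 1, E <= K & E - 1 <= K * `|x| ].
Proof.
move=> xL /=; set E := expR _.
have E0 : 0 < E by exact: expR_gt0.
have e1 : (1 + x) * E <= 1.
  by rewrite -[leRHS](expRxMexpNx_1 x) ler_wpM2r ?(ltW E0)// expR_ge1Dx.
have eK : E <= K by rewrite ler_expR lerNl.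
split => //; first by rewrite expR_ge1Dx.
have [x0|x0] := leP 0 x.
  rewrite ger0_norm//; have := mulr_ge0 x0 (ltW E0); have := mulr_ge0 (le_trans ler01 K1) x0; nra.
by rewrite ltr0_norm//; nra.
Qed.

Lemma one_sub_bound (x : R) : - L <= x -> let E := expR (- x) in
  0 <= 1 - (1 + x) * E <= (1 + K) * x ^+ 2.
Proof.
move=> xL; have [E0 E1 E2 EK _] := exp_facts xL.
move: E0 E1 E2 EK => /=; set E := expR _ => E0 E1 E2 EK.
rewrite subr_ge0 E2/=.
have [x1|x1] := leP 0 (1 + x); first by have := ler_wpM2l x1 E1; nra.
have x2 : 1 <= x ^+ 2 by nra.
have : (- (1 + x)) * E <= (- (1 + x)) * K by rewrite ler_wpM2l//; lra.
nra.
Qed.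

(** [re_num] and [im_num] are the components of [(1 - exp (- Y)) * conj Y] for
[Y = x + i y], that is [|Y|^2] times those of [(1 - exp (- Y)) / Y]. *)
Definition im_num (x y : R) := x * (expR (- x) * sin y) - y * (1 - expR (- x) * cos y).
Definition re_num (x y : R) := x * (1 - expR (- x) * cos y) + y * (expR (- x) * sin y).

Lemma mul_exp_bound (x : R) : - L <= x -> `|x| * expR (- x) <= 1 + L * K.
Proof.
move=> xL; have [E0 E1 E2 EK _] := exp_facts xL.
move: E0 E1 E2 EK; set E := expR _ => E0 E1 E2 EK.
have LK : 0 <= L * K by rewrite mulr_ge0// (le_trans ler01).
have [x0|x0] := leP 0 x; first by rewrite ger0_norm//; nra.
rewrite ltr0_norm//.
have h1 : - x * E <= L * E by rewrite ler_wpM2r ?(ltW E0)//; lra.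
have h2 : L * E <= L * K by rewrite ler_wpM2l.
lra.
Qed.

(** The factor [y (x^2 + y^2)] reflects that [(1 - exp (- Y)) / Y] is analytic at
0 and real on the real axis: its imaginary part is [O(y)] uniformly, including
near the removable singularity. *)
Lemma im_num_bound (x y : R) : - L <= x -> 0 < y < pi ->
  `|im_num x y| <= (2 + L * K + 2 * K) * (y * (x ^+ 2 + y ^+ 2)).
Proof.
move=> xL /andP[y0 ypi].
have [E0 E1 E2 EK _] := exp_facts xL; have /andP[B0 B1] := one_sub_bound xL.
have := mul_exp_bound xL.
have y01 : 0 <= y <= pi by rewrite !ltW.
have s1 := sin_le_id (ltW y0); have s2 := sin_ge_cube y01.
have c1 := cos_le1 y; have c2 := cos_ge_sqr (ltW y0).
rewrite /im_num; move: E0 E1 E2 EK B0 B1; set E := expR _ => E0 E1 E2 EK B0 B1 xE.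
(* isolates the second-order remainders of exp, sin and cos *)
have -> : x * (E * sin y) - y * (1 - E * cos y) =
  - (y * (1 - (1 + x) * E)) - x * E * (y - sin y) - y * E * (1 - cos y) by ring.
have LK : 0 <= L * K by rewrite mulr_ge0// (le_trans ler01).
have h1 : `|- (y * (1 - (1 + x) * E))| <= y * ((1 + K) * x ^+ 2).
  by rewrite normrN ger0_norm ?mulr_ge0 ?(ltW y0)// ler_wpM2l// ltW.
have h2 : `|x * E * (y - sin y)| <= (1 + L * K) * (y * (y ^+ 2 / 2)).
  rewrite normrM ler_pM//; first by rewrite normrM (gtr0_norm E0).
  by rewrite ger0_norm// subr_ge0.
have h3 : `|y * E * (1 - cos y)| <= y * K * (y ^+ 2 / 2).
  rewrite normrM ler_pM//.
    by rewrite gtr0_norm ?mulr_gt0// ler_wpM2l// ltW.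
  by rewrite ger0_norm ?subr_ge0//; lra.
apply: (le_trans (ler_normB _ _)); apply: (le_trans (lerD (le_trans (ler_normB _ _) (lerD h1 h2)) h3)).
have t1 : 0 <= y * x ^+ 2 by rewrite mulr_ge0 ?sqr_ge0 ?ltW.
have t2 : 0 <= y * y ^+ 2 by rewrite mulr_ge0 ?sqr_ge0 ?ltW.
have := mulr_ge0 LK t1; have := mulr_ge0 LK t2.
have := mulr_ge0 (le_trans ler01 K1) t1; have := mulr_ge0 (le_trans ler01 K1) t2.
by move: t1 t2 K1 LK; move: K => k *; lra.
Qed.

(** For large [x] this is better than [im_num_bound]; it gives the quadratic
decay on the right. *)
Lemma im_num_bound_right (x y : R) : 0 <= x -> 0 < y < pi -> `|im_num x y| <= 3 * y.
Proof.
move=> x0 /andP[y0 ypi].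
have xL : - L <= x by rewrite (le_trans _ x0)// oppr_le0.
have [E0 E1 E2 EK _] := exp_facts xL.
have s1 := sin_le_id (ltW y0); have s0 : 0 <= sin y by rewrite sin_ge0_pi// !ltW.
have c1 := cos_le1 y; have c2 := cos_geN1 y.
rewrite /im_num; move: E0 E1 E2 EK; set E := expR _ => E0 E1 E2 EK.
have xE0 : 0 <= x * E by rewrite mulr_ge0// ltW.
have xE : x * E <= 1 by nra.
have EE : E <= 1 by nra.
have h1 : 0 <= x * E * sin y <= y.
  rewrite mulr_ge0//= -[leRHS]mul1r ler_pM//.
have h2 : 0 <= y * (1 - E * cos y) <= 2 * y.
  have a1 : E * cos y <= 1.
    by rewrite (le_trans (ler_wpM2l (ltW E0) c1))// mulr1.
  have a2 : -1 <= E * cos y.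
    by have := ler_wpM2l (ltW E0) c2; lra.
  rewrite mulr_ge0 ?subr_ge0 ?(ltW y0)//= mulrC ler_wpM2r ?(ltW y0)//; lra.
rewrite mulrA ler_norml; lra.
Qed.

Lemma re_num_bound (x y : R) : - L <= x -> 0 < y < pi ->
  `|re_num x y| <= (2 + L * K + 2 * K) * (x ^+ 2 + y ^+ 2).
Proof.
move=> xL /andP[y0 ypi].
have [E0 E1 E2 EK E3] := exp_facts xL.
have := mul_exp_bound xL.
have s1 := sin_le_id (ltW y0); have s0 : 0 <= sin y by rewrite sin_ge0_pi// !ltW.
have c1 := cos_le1 y; have c2 := cos_ge_sqr (ltW y0).
rewrite /re_num; move: E0 E1 E2 EK E3; set E := expR _ => E0 E1 E2 EK E3 xE.
have -> : x * (1 - E * cos y) + y * (E * sin y) =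
  x * (1 - E) + x * E * (1 - cos y) + y * (E * sin y) by ring.
have LK : 0 <= L * K by rewrite mulr_ge0// (le_trans ler01).
have h1 : `|x * (1 - E)| <= (1 + K) * x ^+ 2.
  rewrite normrM -[x ^+ 2]real_normK ?num_real// expr2 mulrCA ler_wpM2l//.
  have xx := ler_norm x.
  rewrite ler_norml mulrDl mul1r; have := mulr_ge0 (le_trans ler01 K1) (normr_ge0 x).
  have := normr_ge0 x.
  move: E1 E3 xx; move: (K * `|x|) => ka; move: (`|x|) => a *; apply/andP; split; lra.
have h2 : `|x * E * (1 - cos y)| <= (1 + L * K) * (y ^+ 2 / 2).
  rewrite normrM ler_pM//; first by rewrite normrM (gtr0_norm E0).
  by rewrite ger0_norm ?subr_ge0//; lra.
have h3 : `|y * (E * sin y)| <= K * y ^+ 2.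
  rewrite ger0_norm ?mulr_ge0 ?(ltW y0) ?(ltW E0)// mulrCA ler_pM ?mulr_ge0 ?(ltW y0) ?(ltW E0)//.
  by rewrite expr2 ler_wpM2l// ltW.
apply: (le_trans (ler_normD _ _)); apply: (le_trans (lerD (le_trans (ler_normD _ _) (lerD h1 h2)) h3)).
have t1 := sqr_ge0 x; have t2 := sqr_ge0 y.
have := mulr_ge0 LK t1; have := mulr_ge0 LK t2.
have := mulr_ge0 (le_trans ler01 K1) t1; have := mulr_ge0 (le_trans ler01 K1) t2.
by move: t1 t2 K1 LK; move: K => k *; lra.
Qed.

End EpsBounds.

(** * The entire function (1 - exp (-Y)) / Y *)

Section Quotient.
Variable R : realType.
Local Notation re := (@complex.Re R).
Local Notation im := (@complex.Im R).

(** Entire once extended by 1 at 0, its removable singularity. *)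
Definition eps (Y : R[i]) : R[i] := (1 - cexp (- Y)) / Y.

Lemma Re_eps Y : re (eps Y) = re_num (re Y) (im Y) / (re Y ^+ 2 + im Y ^+ 2).
Proof.
case: Y => x y; rewrite /eps /re_num !ReImE Re_inv Im_inv /= cosN sinN.
by move: (expR _) (cos _) (sin _) (_^-1) => *; ring.
Qed.

Lemma Im_eps Y : im (eps Y) = im_num (re Y) (im Y) / (re Y ^+ 2 + im Y ^+ 2).
Proof.
case: Y => x y; rewrite /eps /im_num !ReImE Re_inv Im_inv /= cosN sinN.
by move: (expR _) (cos _) (sin _) (_^-1) => *; ring.
Qed.

Lemma Re_shift w (k : R) : re (w - k%:C) = re w - k.
Proof. by rewrite !ReImE. Qed.
Lemma Im_shift w (k : R) : im (w - k%:C) = im w.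
Proof. by rewrite !ReImE /= subr0. Qed.

Section Bounds.
Variable k : R.
Hypothesis k0 : 0 <= k.

Definition eps_const : R := (2 + (1 + k) * expR (1 + k) + 2 * expR (1 + k)) * (3 + k) ^+ 2.

Let L0 : 0 <= 1 + k. Proof. by rewrite addr_ge0. Qed.
Let K0 : 0 <= expR (1 + k). Proof. exact: expR_ge0. Qed.
Let A2 : 2 <= 2 + (1 + k) * expR (1 + k) + 2 * expR (1 + k).
Proof. have := mulr_ge0 L0 K0; move: K0; lra. Qed.

Lemma eps_const_ge0 : 0 <= eps_const.
Proof. by rewrite mulr_ge0 ?sqr_ge0//; move: A2; lra. Qed.

Let normsq_pos w : 0 < im w -> 0 < (re w - k) ^+ 2 + im w ^+ 2.
Proof. by move=> w0; rewrite ltr_wpDl ?sqr_ge0// exprn_gt0. Qed.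

Lemma eps_im_bound w : 0 < im w < pi -> -1 <= re w ->
  `|im (eps (w - k%:C))| <= eps_const * im w / (2 + re w) ^+ 2.
Proof.
move=> wpi w1; rewrite Im_eps Re_shift Im_shift.
have /andP[w0 _] := wpi; have n0 := normsq_pos w0.
have g0 : 0 < (2 + re w) ^+ 2 by rewrite exprn_gt0//; move: w1; lra.
rewrite normrM normfV (gtr0_norm n0) ler_pdivrMr// mulrAC ler_pdivlMr//.
set x := re w - k in n0 *; have xL : - (1 + k) <= x by rewrite /x; move: w1; lra.
have wE : re w = x + k by rewrite /x subrK.
have [x1|x1] := leP x 1.
  apply: (@le_trans _ _ ((2 + (1 + k) * expR (1 + k) + 2 * expR (1 + k)) * (im w * (x ^+ 2 + im w ^+ 2)) * (3 + k) ^+ 2)).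
    rewrite ler_pM ?sqr_ge0//; first exact: im_num_bound.
    rewrite ler_pXn2r ?nnegrE//; move: w1 x1 wE k0; lra.
  by rewrite /eps_const le_eqVlt; apply/orP; left; apply/eqP; ring.
have x0 : 0 <= x by rewrite (le_trans _ (ltW x1)).
apply: (@le_trans _ _ (3 * im w * ((3 + k) ^+ 2 * x ^+ 2))).
  rewrite ler_pM ?sqr_ge0//; first exact: (im_num_bound_right L0).
  rewrite -exprMn ler_pXn2r ?nnegrE//; move: w1 x1 wE k0 => *; nra.
rewrite /eps_const.
have h1 : 0 <= im w * ((3 + k) ^+ 2 * x ^+ 2).
  by apply: mulr_ge0 (ltW w0) (mulr_ge0 _ _); exact: sqr_ge0.
have h2 : 0 <= im w * ((3 + k) ^+ 2 * im w ^+ 2).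
  by apply: mulr_ge0 (ltW w0) (mulr_ge0 _ _); exact: sqr_ge0.
have A3 : 3 <= 2 + (1 + k) * expR (1 + k) + 2 * expR (1 + k).
  have := mulr_ge0 L0 K0; have := expR_ge1Dx (1 + k); move: k0.
  lra.
move: A3 h1 h2; move: (2 + _ + _) => A; move: (3 + k) => B.
move: (im w) => y A3 h1 h2; nra.
Qed.

Lemma eps_re_bound w : 0 < im w < pi -> -1 <= re w ->
  `|re (eps (w - k%:C))| <= eps_const.
Proof.
move=> wpi w1; rewrite Re_eps Re_shift Im_shift.
have /andP[w0 _] := wpi; have n0 := normsq_pos w0.
rewrite normrM normfV (gtr0_norm n0) ler_pdivrMr//.
set x := re w - k in n0 *; have xL : - (1 + k) <= x by rewrite /x; move: w1; lra.
apply: (le_trans (re_num_bound L0 xL wpi)); rewrite ler_wpM2r ?(ltW n0)//.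
rewrite /eps_const ler_peMr//; first by move: A2; lra.
by rewrite expr_ge1//; move: k0; lra.
Qed.

(** With [Y = w - k = x + i y], the quantity [1 + k eps Y] is [D / Y] for
[D = Y + k (1 - exp (- Y))], and one needs [|Y| = O(|D|)].  Always [Im D >= y];
if [x >= 0] then [Re D >= x].  If [x < 0], either [|x| <= (2 + k) y], or [y] is so
small that [exp (- x) cos y >= 1] and [Re D <= x]. *)
Lemma denom_normsq_ge w : 0 < im w < pi -> -1 <= re w ->
  1 <= (1 + (2 + k) ^+ 2) * (re (1 + k%:C * eps (w - k%:C)) ^+ 2 +
    im (1 + k%:C * eps (w - k%:C)) ^+ 2).
Proof.
move=> wpi w1; have /andP[w0 wp] := wpi; have n0 := normsq_pos w0.
set e := eps (w - k%:C).
have -> : re (1 + k%:C * e) = 1 + k * re e by rewrite Re_add Re_mul /= mul0r subr0.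
have -> : im (1 + k%:C * e) = k * im e by rewrite Im_add Im_mul /= mul0r addr0 add0r.
rewrite /e Re_eps Im_eps Re_shift Im_shift.
move: n0 w0 wpi wp.
set x := re w - k; set y := im w => n0 w0 wpi wp.
have xL : - (1 + k) <= x by rewrite /x; move: w1; lra.
set E := expR (- x).
have [E0 E1 _ _ _] := exp_facts L0 xL; rewrite -/E in E0 E1.
(* the components of (Y + k (1 - exp (- Y))) *)
pose D1 := x + k * (1 - E * cos y); pose D2 := y + k * (E * sin y).
have -> : (1 + k * (re_num x y / (x ^+ 2 + y ^+ 2))) ^+ 2 +
     (k * (im_num x y / (x ^+ 2 + y ^+ 2))) ^+ 2 =
     (D1 ^+ 2 + D2 ^+ 2) / (x ^+ 2 + y ^+ 2).
  rewrite /re_num /im_num -/E /D1 /D2; clear E0 E1; clearbody E x y; move: n0; move: (cos y) (sin y) => *.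
  by field; rewrite gt_eqF.
rewrite mulrA ler_pdivlMr// mul1r.
have y0 := ltW w0; have ypi : 0 <= y <= pi by rewrite y0 ltW.
have s0 : 0 <= sin y by rewrite sin_ge0_pi.
have D2y : y <= D2 by rewrite /D2 lerDl !mulr_ge0// ltW.
have D22 : y ^+ 2 <= D2 ^+ 2 by rewrite ler_pXn2r ?nnegrE// (le_trans y0).
suff [h|h] : x ^+ 2 <= D1 ^+ 2 \/ x ^+ 2 <= (2 + k) ^+ 2 * y ^+ 2.
- have := mulr_ge0 (sqr_ge0 (2 + k)) (addr_ge0 (sqr_ge0 D1) (sqr_ge0 D2)).
  by move: (2 + k) => *; nra.
- have := mulr_ge0 (sqr_ge0 (2 + k)) (sqr_ge0 D1); have := sqr_ge0 D1.
  have := ler_wpM2l (sqr_ge0 (2 + k)) D22.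
  by move: (2 + k) h => *; nra.
have [x0|x0] := leP 0 x.
  left; rewrite ler_pXn2r ?nnegrE//; last first.
    rewrite /D1 addr_ge0// mulr_ge0// subr_ge0.
    apply: (@le_trans _ _ E); last by rewrite -expR0 ler_expR oppr_le0.
    by rewrite ler_piMr ?(ltW E0) ?cos_le1.
  rewrite /D1 lerDl mulr_ge0// subr_ge0.
  apply: (@le_trans _ _ E); last by rewrite -expR0 ler_expR oppr_le0.
  by rewrite ler_piMr ?(ltW E0) ?cos_le1.
have [xy|xy] := leP (- x) ((2 + k) * y).
  by right; rewrite -sqrrN -exprMn ler_pXn2r ?nnegrE//; move: x0 xy; lra.
left.
have c1 := cos_ge_sqr y0.
have Ec : 1 <= E * cos y.
  have yx : (2 + k) ^+ 2 * y ^+ 2 <= x ^+ 2.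
    by rewrite -exprMn -[x ^+ 2]sqrrN ler_pXn2r ?nnegrE ?mulr_ge0 ?addr_ge0//; move: x0 xy; lra.
  have x2 : x ^+ 2 <= (1 + k) * - x by move: xL x0 => *; nra.
  have yb : (1 - x) * (y ^+ 2 / 2) <= - x.
    rewrite -(@ler_pM2l _ ((2 + k) ^+ 2)); last by rewrite exprn_gt0//; move: k0; lra.
    have y2 := sqr_ge0 y.
    have h1 : (1 - x) * ((2 + k) ^+ 2 * y ^+ 2) <= (1 - x) * x ^+ 2.
      by rewrite ler_wpM2l//; move: x0; lra.
    have h2 : (1 - x) * x ^+ 2 <= (2 + k) * ((2 + k) * - x).
      by rewrite ler_pM ?sqr_ge0//; move: x0 xL x2 k0 => *; nra.
    have h3 : 0 <= (2 + k) ^+ 2 * - x by rewrite mulr_ge0 ?sqr_ge0// oppr_ge0 ltW.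
    move: h1 h2 h3; move: (2 + k) => B h1 h2 h3; lra.
  have c0 : 0 <= 1 - y ^+ 2 / 2.
    have h1 := sqr_ge0 y; move: yb x0; move: (y ^+ 2) h1 => z *; nra.
  apply: (@le_trans _ _ ((1 - x) * (1 - y ^+ 2 / 2))); first by move: yb; lra.
  by rewrite ler_pM//; move: x0; lra.
have D1x : D1 <= x by rewrite /D1 gerDl mulr_ge0_le0// subr_le0.
by rewrite -[x ^+ 2]sqrrN -[D1 ^+ 2]sqrrN ler_pXn2r ?nnegrE ?lerN2 ?oppr_ge0 ?(ltW x0)// (le_trans D1x (ltW x0)).
Qed.

End Bounds.
End Quotient.

(** * The analytic factor of the contour integrand *)

Section QuotientAnalytic.
Variable R : realType.
Local Notation re := (@complex.Re R).
Local Notation im := (@complex.Im R).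

Definition eps' (Y : R[i]) : R[i] := (cexp (- Y) - eps Y) / Y.

Lemma eps_deriv (f : R -> R[i]) (x : R) d : f x != 0 -> is_cderive f x d ->
  is_cderive (fun t => eps (f t)) x (eps' (f x) * d).
Proof.
move=> f0 df.
have h := is_cderiveM (is_cderiveD (is_cderive_cst 1 x)
   (is_cderiveN (is_cderive_cexp (is_cderiveN df)))) (is_cderiveV f0 df).
apply: (is_cderive_eq h); rewrite /eps' /eps.
by move: (cexp _) f0; move: (f x) => u v f0; field.
Qed.

Lemma eps_cont (T : topologicalType) (f : T -> R[i]) t : f t != 0 ->
  ccontinuous f t -> ccontinuous (fun s => eps (f s)) t.
Proof.
move=> f0 cf; apply: ccontinuousM (ccontinuousV f0 cf).
by apply: (ccontinuousD (ccontinuous_cst _ _)); apply: ccontinuousN;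
  apply: ccontinuous_cexp; exact: ccontinuousN.
Qed.

Lemma eps'_cont (T : topologicalType) (f : T -> R[i]) t : f t != 0 ->
  ccontinuous f t -> ccontinuous (fun s => eps' (f s)) t.
Proof.
move=> f0 cf; apply: ccontinuousM (ccontinuousV f0 cf).
apply: ccontinuousD; first by apply: ccontinuous_cexp; exact: ccontinuousN.
by apply: ccontinuousN; exact: eps_cont.
Qed.

Definition factor (p : R) (w : R[i]) : R[i] := 1 + p%:C * eps (w - p%:C).
Definition factor' (p : R) (w : R[i]) : R[i] := p%:C * eps' (w - p%:C).

Lemma shift_neq0 (p : R) w : 0 < im w -> w - p%:C != 0.
Proof. by move=> w0; apply: neq0_im; rewrite Im_shift gt_eqF. Qed.

Lemma factor_deriv p (f : R -> R[i]) (x : R) d : 0 < im (f x) -> is_cderive f x d ->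
  is_cderive (fun t => factor p (f t)) x (factor' p (f x) * d).
Proof.
move=> f0 df.
have h := eps_deriv (f := fun t => f t - p%:C) (shift_neq0 p f0)
   (is_cderiveD df (is_cderiveN (is_cderive_cst p%:C x))).
apply: (is_cderive_eq (is_cderiveD (is_cderive_cst 1 x) (is_cderiveM (is_cderive_cst p%:C x) h))).
by rewrite /factor'; ring.
Qed.

Lemma factor_cont p (T : topologicalType) (f : T -> R[i]) t : 0 < im (f t) ->
  ccontinuous f t -> ccontinuous (fun s => factor p (f s)) t.
Proof.
move=> f0 cf; apply: (ccontinuousD (ccontinuous_cst _ _)).
apply: (ccontinuousM (ccontinuous_cst _ _)).
apply: (eps_cont (f := fun s => f s - p%:C)); first exact: shift_neq0.
exact: (ccontinuousD cf (ccontinuous_cst _ _)).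
Qed.

Lemma factor'_cont p (T : topologicalType) (f : T -> R[i]) t : 0 < im (f t) ->
  ccontinuous f t -> ccontinuous (fun s => factor' p (f s)) t.
Proof.
move=> f0 cf; apply: (ccontinuousM (ccontinuous_cst _ _)).
apply: (eps'_cont (f := fun s => f s - p%:C)); first exact: shift_neq0.
exact: (ccontinuousD cf (ccontinuous_cst _ _)).
Qed.

Lemma factor_shift p w : 0 < im w ->
  factor p w * (w - p%:C) = w - p%:C + p%:C * (1 - cexp (- (w - p%:C))).
Proof.
move=> w0; rewrite /factor /eps; have := shift_neq0 p w0.
by move: (w - _) (cexp _) => u v u0; field.
Qed.

(** The imaginary part of [Y + k (1 - exp (- Y))] is at least that of [Y], for
[Y = w - k] in the strip. *)
Lemma factor_neq0 p w : 0 <= p -> 0 < im w < pi -> factor p w != 0.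
Proof.
move=> p0 /andP[w0 wpi].
suff : factor p w * (w - p%:C) != 0 by apply: contraNneq => ->; rewrite mul0r.
rewrite factor_shift//; apply: neq0_im; rewrite gt_eqF//.
rewrite Im_add Im_shift Im_scale Im_add Im_opp [im 1]/= [im (cexp _)]/= Im_opp.
rewrite Im_shift sinN Re_opp Re_shift.
rewrite mulrN opprK add0r ltr_pwDl// mulr_ge0// mulr_ge0 ?expR_ge0//.
by rewrite sin_ge0_pi// !ltW.
Qed.

Section Ratio.
Variables p q : R.
Hypotheses (p0 : 0 <= p) (q0 : 0 <= q).

(** This is [((w e^w - p e^p) / (w - p)) * ((w - q) / (w e^w - q e^q))]: dividing
both factors by [e^w] makes them bounded. *)
Definition ratio w := factor p w / factor q w.
Definition ratio' w :=
  (factor' p w * factor q w - factor p w * factor' q w) / factor q w ^+ 2.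

Lemma ratio_deriv (f : R -> R[i]) (x : R) d : 0 < im (f x) < pi -> is_cderive f x d ->
  is_cderive (fun t => ratio (f t)) x (ratio' (f x) * d).
Proof.
move=> fx df; have /andP[f0 _] := fx; have F0 := factor_neq0 q0 fx.
apply: (is_cderive_eq (is_cderiveM (factor_deriv p f0 df)
  (is_cderiveV F0 (factor_deriv q f0 df)))).
rewrite /ratio'; move: F0.
by move: (factor p _) (factor q _) (factor' p _) (factor' q _) => *; field.
Qed.

Lemma ratio'_cont (T : topologicalType) (f : T -> R[i]) t : 0 < im (f t) < pi ->
  ccontinuous f t -> ccontinuous (fun s => ratio' (f s)) t.
Proof.
move=> fx cf; have /andP[f0 _] := fx; have F0 := factor_neq0 q0 fx.
have c1 := factor_cont p f0 cf; have c2 := factor_cont q f0 cf.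
have c3 := factor'_cont p f0 cf; have c4 := factor'_cont q f0 cf.
apply: ccontinuousM.
  exact: (ccontinuousD (ccontinuousM c3 c2) (ccontinuousN (ccontinuousM c1 c4))).
by apply: ccontinuousV; [rewrite expf_neq0|exact: ccontinuousM].
Qed.

Lemma Re_factor k w : re (factor k w) = 1 + k * re (eps (w - k%:C)).
Proof. by rewrite Re_add Re_scale. Qed.
Lemma Im_factor k w : im (factor k w) = k * im (eps (w - k%:C)).
Proof. by rewrite Im_add Im_scale add0r. Qed.

Lemma factor_re_bound k w : 0 <= k -> 0 < im w < pi -> -1 <= re w ->
  `|re (factor k w)| <= 1 + k * eps_const k.
Proof.
move=> k0 wpi w1; rewrite Re_factor (le_trans (ler_normD _ _))// normr1 lerD2l.
by rewrite normrM ger0_norm// ler_wpM2l// eps_re_bound.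
Qed.

Lemma factor_im_bound k w : 0 <= k -> 0 < im w < pi -> -1 <= re w ->
  `|im (factor k w)| <= k * eps_const k * (im w / (2 + re w) ^+ 2).
Proof.
move=> k0 wpi w1; rewrite Im_factor normrM ger0_norm// -mulrA ler_wpM2l//.
by rewrite mulrA eps_im_bound.
Qed.

(** Both factors satisfy the estimate, they are bounded, and the denominator is
bounded below; the estimate passes to the quotient since it bears on imaginary
parts only. *)
Lemma ratio_bounds : exists B, [/\ 0 <= B,
  forall w, 0 < im w < pi -> -1 <= re w -> `|im (ratio w)| <= B * im w / (2 + re w) ^+ 2 &
  forall w, 0 < im w < pi -> -1 <= re w -> `|re (ratio w)| <= B /\ `|im (ratio w)| <= B].
Proof.
pose P := p * eps_const p; pose Q := q * eps_const q.
have P0 : 0 <= P by rewrite mulr_ge0// eps_const_ge0.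
have Q0 : 0 <= Q by rewrite mulr_ge0// eps_const_ge0.
pose m := 1 + (2 + q) ^+ 2.
have m0 : 0 <= m by rewrite addr_ge0// sqr_ge0.
pose B1 := m * (P * (1 + Q) + (1 + P) * Q).
have B10 : 0 <= B1 by rewrite mulr_ge0// addr_ge0// mulr_ge0// addr_ge0.
pose B2 := m * ((1 + P) * (1 + Q) + (P * 4) * (Q * 4)).
have B20 : 0 <= B2.
  apply: (mulr_ge0 m0 (addr_ge0 (mulr_ge0 (addr_ge0 ler01 P0) (addr_ge0 ler01 Q0)) _)).
  exact: (mulr_ge0 (mulr_ge0 P0 (ler0n _ 4)) (mulr_ge0 Q0 (ler0n _ 4))).
have B14 : 0 <= B1 * 4 by rewrite mulr_ge0.
have nb w x : 0 < im w < pi -> -1 <= re w ->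
    `|x / (re (factor q w) ^+ 2 + im (factor q w) ^+ 2)| <= m * `|x|.
  move=> wpi w1; have n0 := normsq_gt0 (factor_neq0 q0 wpi).
  rewrite normrM normfV (gtr0_norm n0) ler_pdivrMr// mulrAC ler_peMl//.
  exact: denom_normsq_ge.
have gb w : 0 < im w < pi -> -1 <= re w -> 0 <= im w / (2 + re w) ^+ 2 <= 4.
  move=> /andP[w0 wpi] w1; rewrite divr_ge0 ?sqr_ge0 ?(ltW w0)//=.
  rewrite ler_pdivrMr; last by rewrite exprn_gt0//; move: w1; lra.
  have := pi_le4 R; have : 1 <= (2 + re w) ^+ 2 by rewrite expr_ge1//; move: w1; lra.
  by move: wpi; move: (pi : R) => *; lra.
have imb w : 0 < im w < pi -> -1 <= re w -> `|im (ratio w)| <= B1 * (im w / (2 + re w) ^+ 2).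
  move=> wpi w1; have /andP[g0 _] := gb w wpi w1.
  rewrite /ratio Im_div (le_trans (nb _ _ wpi w1))// /B1 -mulrA ler_wpM2l//.
  have a1 := factor_im_bound p0 wpi w1; have a2 := factor_im_bound q0 wpi w1.
  have a3 := factor_re_bound p0 wpi w1; have a4 := factor_re_bound q0 wpi w1.
  rewrite -/P in a1 a3; rewrite -/Q in a2 a4.
  rewrite (le_trans (ler_normB _ _))// mulrDl lerD//.
    by rewrite normrM mulrAC ler_pM.
  by rewrite normrM -mulrA ler_pM.
exists (B1 * 4 + B2 + B1); split.
- by rewrite !addr_ge0.
- move=> w wpi w1; rewrite -mulrA (le_trans (imb w wpi w1))// ler_wpM2r//.
    by have /andP[] := gb w wpi w1.
  by rewrite lerDr addr_ge0.
- move=> w wpi w1; have /andP[g0 g4] := gb w wpi w1; split.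
    have a1 := factor_im_bound p0 wpi w1; have a2 := factor_im_bound q0 wpi w1.
    have a3 := factor_re_bound p0 wpi w1; have a4 := factor_re_bound q0 wpi w1.
    apply: (@le_trans _ _ B2); last by rewrite -addrA [_ + (_ + _)]addrCA lerDl addr_ge0// mulr_ge0.
    rewrite /ratio Re_div (le_trans (nb _ _ wpi w1))// /B2 ler_wpM2l//.
    rewrite (le_trans (ler_normD _ _))// lerD// normrM ler_pM//.
      by rewrite (le_trans a1)// ler_wpM2l.
    by rewrite (le_trans a2)// ler_wpM2l.
  apply: (le_trans (imb w wpi w1)); apply: (@le_trans _ _ (B1 * 4)).
    by rewrite ler_wpM2l.
  by rewrite -addrA lerDl addr_ge0.
Qed.

End Ratio.

(** The restriction of [eps] to the real axis, extended by continuity at 0. *)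
Definition reps (x : R) : R := if x == 0 then 1 else (1 - expR (- x)) / x.

Lemma reps_gt0 x : 0 < reps x.
Proof.
rewrite /reps; case: eqVneq => [_|x0]; first exact: ltr01.
have [xp|xn] : 0 < x \/ x < 0.
  by move: x0; rewrite neq_lt => /orP[|]; [right|left].
  by rewrite divr_gt0// subr_gt0 expR_lt1 oppr_lt0.
by rewrite nmulr_lgt0 ?invr_lt0// subr_lt0 expR_gt1 oppr_gt0.
Qed.

Let rn (n : nat) : R := n.+1%:R^-1.
Let rn0 n : rn n != 0. Proof. by rewrite invr_neq0// pnatr_eq0. Qed.
Let rn_cvg : rn n @[n --> \oo] --> 0.
Proof. exact: cvg_harmonic. Qed.

Lemma diff_quotient_cvg (F : R -> R) (D : R) : is_derive (0:R) 1 F D ->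
  (fun n => n.+1%:R * (F (rn n) - F 0)) @ \oo --> D.
Proof.
move=> [dF DE].
have hc : h^-1 *: ((F \o shift 0) (h *: (1:R)) - F 0) @[h --> 0^'] --> D.
  by rewrite -DE; exact: dF.
have := (cvgr_dnbhsP _ _ _).1 hc rn (conj rn0 rn_cvg).
rewrite (_ : (fun n => n.+1%:R * _) = (fun n => (rn n)^-1 *: (F (rn n *: 1 + 0) - F 0))) //.
by apply/funext => n; rewrite /rn invrK addr0 /GRing.scale/= mulr1.
Qed.

(** When [k = p] the argument of [eps] tends to its removable singularity, and the
limit is read off the derivative of [r |-> exp (- r z)] at 0. *)
Lemma eps_lim (k p : R) (z : R[i]) : 0 < im z ->
  (fun n => re (eps (k%:C + (rn n)%:C * z - p%:C))) @ \oo --> reps (k - p) /\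
  (fun n => im (eps (k%:C + (rn n)%:C * z - p%:C))) @ \oo --> 0.
Proof.
move=> z0; rewrite /reps subr_eq0; case: eqVneq => [->|kp].
  pose g (r : R) : R[i] := cexp (- (r%:C * z)).
  have did : is_cderive (fun r : R => r%:C) 0 1.
    by split => /=; [exact: is_derive_id|exact: is_derive_cst].
  have dg := is_cderive_cexp (is_cderiveN (is_cderiveM did (is_cderive_cst z 0))).
  have g0 : g 0 = 1 by rewrite /g mul0r oppr0 /cexp /= expR0 cos0 sin0 mulr1 mulr0.
  have [d1 d2] : is_cderive g 0 (- z).
    by apply: (is_cderive_eq dg); rewrite mulr0 addr0 mul1r -/(g 0) g0 mul1r.
  have e1 : (fun n => n.+1%:R * (re (g (rn n)) - re (g 0))) @ \oo --> re (- z).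
    exact: diff_quotient_cvg d1.
  have e2 : (fun n => n.+1%:R * (im (g (rn n)) - im (g 0))) @ \oo --> im (- z).
    exact: diff_quotient_cvg d2.
  have zn0 : z != 0 by apply: neq0_im; rewrite gt_eqF.
  have epsE n : eps (p%:C + (rn n)%:C * z - p%:C) =
      - ((n.+1%:R : R)%:C * (g (rn n) - g 0)) / z.
    rewrite addrAC subrr add0r /eps -/(g (rn n)) g0.
    have -> : (n.+1%:R : R)%:C = (rn n)%:C^-1 by rewrite -fmorphV /rn invrK.
    have : (rn n)%:C != 0 by rewrite fmorph_eq0.
    by move: ((rn n)%:C) (g _) => u v u0; field; rewrite zn0.
  have reE n : re ((n.+1%:R : R)%:C * (g (rn n) - g 0)) = n.+1%:R * (re (g (rn n)) - re (g 0)).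
    by rewrite Re_scale !ReImE.
  have imE n : im ((n.+1%:R : R)%:C * (g (rn n) - g 0)) = n.+1%:R * (im (g (rn n)) - im (g 0)).
    by rewrite Im_scale !ReImE.
  have zz : - - z / z = 1 by rewrite opprK divff.
  have cvgE (u : nat -> R) (l l' : R) : l = l' -> u @ \oo --> l -> u @ \oo --> l'.
    by move=> ->.
  have zr : - re (- z) * re z^-1 - - im (- z) * im z^-1 = 1.
    by rewrite -Re_opp -Im_opp -Re_mul zz.
  have zi : - re (- z) * im z^-1 + - im (- z) * re z^-1 = 0.
    by rewrite -Re_opp -Im_opp -Im_mul zz.
  split.
    under eq_fun do rewrite epsE Re_mul Re_opp Im_opp reE imE.
    apply: (cvgE _ _ _ zr).
    by apply: cvgB; apply: cvgMl; apply: cvgN; [exact: e1|exact: e2].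
  under eq_fun do rewrite epsE Im_mul Re_opp Im_opp reE imE.
  apply: (cvgE _ _ _ zi).
  by apply: cvgD; apply: cvgMl; apply: cvgN; [exact: e1|exact: e2].
pose f (r : R) : R[i] := k%:C + r%:C * z - p%:C.
have kp0 : k - p != 0 by rewrite subr_eq0.
have f0 : f 0 = (k - p)%:C by rewrite /f mul0r addr0 -raddfB.
have cf : ccontinuous f 0.
  apply: ccontinuousD; last exact: ccontinuous_cst.
  apply: (ccontinuousD (ccontinuous_cst _ _)); apply: ccontinuousM; last exact: ccontinuous_cst.
  by split => /=; [exact: cvg_id|exact: cvg_cst].
have [|c1 c2] := eps_cont _ cf; first by rewrite f0 fmorph_eq0.
have re0 : re (eps (f 0)) = (1 - expR (- (k - p))) / (k - p).
  rewrite f0 Re_eps /= /re_num cos0 sin0 mul0r expr0n/= !addr0 mulr1.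
  by field.
have im0 : im (eps (f 0)) = 0.
  by rewrite f0 Im_eps /= /im_num cos0 sin0 !mul0r !mulr0 subr0 mul0r.
split.
- by rewrite -re0; apply: (@cvg_comp _ _ _ rn (fun r => re (eps (f r))) _ _ _ rn_cvg c1).
- by rewrite -im0; apply: (@cvg_comp _ _ _ rn (fun r => im (eps (f r))) _ _ _ rn_cvg c2).
Qed.

Lemma ratio_lim (k p q : R) (z : R[i]) : 0 <= q -> 0 < im z ->
  (fun n => re (ratio p q (k%:C + (rn n)%:C * z))) @ \oo -->
     (1 + p * reps (k - p)) / (1 + q * reps (k - q)) /\
  (fun n => im (ratio p q (k%:C + (rn n)%:C * z))) @ \oo --> 0.
Proof.
move=> q0 z0.
have [p1 p2] := eps_lim k p z0; have [q1 q2] := eps_lim k q z0.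
set P := 1 + p * _; set Q := 1 + q * _.
have Q0 : Q != 0 by rewrite gt_eqF// ltr_pwDl// mulr_ge0// ltW// reps_gt0.
have cP1 : (fun n => re (factor p (k%:C + (rn n)%:C * z))) @ \oo --> P.
  under eq_fun do rewrite Re_factor.
  by apply: cvgD; [exact: cvg_cst|apply: cvgMr; exact: p1].
have cP2 : (fun n => im (factor p (k%:C + (rn n)%:C * z))) @ \oo --> 0.
  by under eq_fun do rewrite Im_factor; rewrite -(mulr0 p); apply: cvgMr; exact: p2.
have cQ1 : (fun n => re (factor q (k%:C + (rn n)%:C * z))) @ \oo --> Q.
  under eq_fun do rewrite Re_factor.
  by apply: cvgD; [exact: cvg_cst|apply: cvgMr; exact: q1].
have cQ2 : (fun n => im (factor q (k%:C + (rn n)%:C * z))) @ \oo --> 0.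
  by under eq_fun do rewrite Im_factor; rewrite -(mulr0 q); apply: cvgMr; exact: q2.
have cn : (fun n => (re (factor q (k%:C + (rn n)%:C * z)) ^+ 2 +
    im (factor q (k%:C + (rn n)%:C * z)) ^+ 2)^-1) @ \oo --> (Q * Q + 0 * 0)^-1.
  apply: cvgV; first by rewrite mulr0 addr0 mulf_neq0.
  by under eq_fun do rewrite 2!expr2; apply: cvgD; exact: cvgM.
split.
  under eq_fun do rewrite /ratio Re_div.
  rewrite (_ : P / Q = (P * Q + 0 * 0) / (Q * Q + 0 * 0)); last by field.
  by apply: cvgM => //; apply: cvgD; exact: cvgM.
under eq_fun do rewrite /ratio Im_div.
rewrite (_ : 0 = (0 * Q - P * 0) / (Q * Q + 0 * 0)); last by rewrite mul0r mulr0 subr0 mul0r.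
by apply: cvgM => //; apply: cvgB; exact: cvgM.
Qed.

End QuotientAnalytic.

(** * The boundary curve of the Lambert function *)

Section Curve.
Variable R : realType.
Local Notation re := (@complex.Re R).
Local Notation im := (@complex.Im R).
Local Notation mu := (@lebesgue_measure R).

(** The real part of the point of imaginary part [v] on the image by [W] of the
upper side of the cut: it makes [w e^w] a negative real. *)
Definition cut_re (v : R) : R := - (v * cos v / sin v).
Definition cut_re' (v : R) : R := (v - sin v * cos v) / sin v ^+ 2.

Let sin_pos (v : R) : 0 < v < pi -> 0 < sin v.
Proof. exact: sin_gt0_pi. Qed.

Lemma cut_re_deriv (v : R) : 0 < v < pi -> is_derive v 1 cut_re (cut_re' v).
Proof.
move=> v0; have s0 : sin v != 0 by rewrite gt_eqF ?sin_pos.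
apply: (is_derive_eq (is_deriveN (is_deriveM (is_deriveM (is_derive_id v 1) (is_derive_cos v))
  (is_deriveV s0 (is_derive_sin v))))).
rewrite /cut_re' /GRing.scale/= !fctE /=.
have <- : v * (cos v ^+ 2 + sin v ^+ 2) - sin v * cos v = v - sin v * cos v.
  by rewrite cos2Dsin2 mulr1.
by move: (cos v) (sin v) s0 => a b b0; field.
Qed.

Lemma cut_re'_cont (v : R) : 0 < v < pi -> {for v, continuous cut_re'}.
Proof.
move=> v0; have s0 : sin v != 0 by rewrite gt_eqF ?sin_pos.
have cs := @continuous_sin R v; have cc := @continuous_cos R v.
rewrite /cut_re'; apply: cvgM; first by apply: cvgB; [exact: cvg_id|exact: cvgM].
apply: cvgV; first by rewrite expf_neq0.
by under eq_fun do rewrite expr2; exact: cvgM.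
Qed.

Lemma cut_re_ge (v : R) : 0 < v < pi -> -1 <= cut_re v.
Proof.
move=> v0; rewrite /cut_re lerN2 ler_pdivrMr ?sin_pos// mul1r.
by apply: sin_ge_mul_cos; case/andP: v0 => *; rewrite !ltW.
Qed.

(** The intervals [[cut_lo n, cut_hi n]] exhaust [(0, pi)]; starting at [pi / 3]
keeps [cos (cut_lo n)] away from 0. *)
Definition cut_lo (n : nat) : R := pi / n.+3%:R.
Definition cut_hi (n : nat) : R := pi - cut_lo n.

Lemma cut_lo_gt0 n : 0 < cut_lo n.
Proof. by rewrite divr_gt0 ?pi_gt0. Qed.

Lemma cut_lo_mul n : cut_lo n * n.+3%:R = pi.
Proof. by rewrite divfK// pnatr_eq0. Qed.

Lemma cut_lo_lt_hi n : cut_lo n < cut_hi n.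
Proof.
rewrite /cut_hi ltrBrDr -(cut_lo_mul n) -!natr1 -[X in X + X]mulr1 -mulrDr ltr_pM2l ?cut_lo_gt0//.
by have : 0 <= (n%:R : R) := ler0n _ _; lra.
Qed.

Lemma cut_hi_lt_pi n : cut_hi n < pi.
Proof. by rewrite gtrBl cut_lo_gt0. Qed.

Lemma cut_lo_le n : cut_lo n <= 4 / 3.
Proof.
have h : 3 * cut_lo n <= pi.
  rewrite -(cut_lo_mul n) mulrC ler_pM2l ?cut_lo_gt0//.
  by rewrite (ler_nat R 3 n.+3).
by have := pi_le4 R; move: h; move: (pi : R) => x *; lra.
Qed.

Lemma cut_lo_in n : 0 < cut_lo n < pi.
Proof. by rewrite cut_lo_gt0 (lt_trans (cut_lo_lt_hi n))// cut_hi_lt_pi. Qed.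

Lemma cut_hi_in n : 0 < cut_hi n < pi.
Proof. by rewrite cut_hi_lt_pi (lt_trans (cut_lo_gt0 n))// cut_lo_lt_hi. Qed.

Lemma cos_lo_ge n : 1 / 9 <= cos (cut_lo n).
Proof.
apply: le_trans (cos_ge_sqr (ltW (cut_lo_gt0 n))).
have := cut_lo_le n; have := cut_lo_gt0 n; move: (cut_lo n) => x *; nra.
Qed.

Lemma cut_re_hi_ge n : n%:R / 9 <= cut_re (cut_hi n).
Proof.
have s0 := sin_pos (cut_lo_in n).
have -> : cut_re (cut_hi n) = (pi - cut_lo n) * cos (cut_lo n) / sin (cut_lo n).
  rewrite /cut_re /cut_hi sinB cosB sinpi cospi.
  by move: (pi : R) (cut_lo n) (sin _) (cos _) s0 => P x S C s0; field; rewrite gt_eqF.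
rewrite ler_pdivlMr//.
have := sin_le_id (ltW (cut_lo_gt0 n)); have := cos_lo_ge n; have := cut_lo_gt0 n.
have piE : pi = cut_lo n * (n%:R + 3) by rewrite -natrD addn3 cut_lo_mul.
rewrite piE; move: (ler0n R n); move: (n%:R : R) (cut_lo n) (cos _) (sin _) s0 => N x C S s0 N0 x0 C0 Sx.
have h1 : N / 9 * S <= N / 9 * x by rewrite ler_wpM2l// divr_ge0.
have h2 : (x * (N + 3) - x) * (1 / 9) <= (x * (N + 3) - x) * C.
  by rewrite ler_wpM2l//; nra.
have h3 : 0 <= x * N by rewrite mulr_ge0 ?(ltW x0).
apply: le_trans h2; lra.
Qed.

Lemma cut_re_lo_le n : cut_re (cut_lo n) <= - (1 / 9).
Proof.
have s0 := sin_pos (cut_lo_in n).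
rewrite /cut_re lerN2 ler_pdivlMr//.
have := sin_le_id (ltW (cut_lo_gt0 n)); have := cos_lo_ge n; have := cut_lo_gt0 n.
move: (cut_lo n) (cos _) (sin _) s0 => x C S s0 x0 C0 Sx; nra.
Qed.

Lemma cut_lo_cvg : cut_lo @ \oo --> 0.
Proof.
rewrite /cut_lo -(mulr0 (pi : R)); apply: cvgMr.
rewrite (_ : (fun n => _) = (fun n => @harmonic R (n + 2)%N)).
  by rewrite cvg_shiftn; exact: cvg_harmonic.
by apply/funext => n; rewrite /harmonic/= addn2.
Qed.

Lemma cut_re_hi_cvg k : (fun n => cut_re (cut_hi n) - k) @ \oo --> +oo.
Proof.
apply/cvgryPge => A; have := nbhs_infty_ger (9 * (A + k)); apply: filterS => n hn.
by have := cut_re_hi_ge n; lra.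
Qed.

Section Angle.
Variable k : R.
Hypothesis k0 : 0 <= k.

Lemma angle_cvg : (fun n => angle k cut_re (cut_lo n) (cut_hi n)) @ \oo --> - (pi : R).
Proof.
have a1 : (fun n => (k - cut_re (cut_lo n)) / cut_lo n) @ \oo --> +oo.
  apply/cvgryPge => A; have := nbhs_infty_ger (36 * A); apply: filterS => n hn.
  rewrite ler_pdivlMr ?cut_lo_gt0//.
  have h1 := cut_re_lo_le n; have h2 := cut_lo_mul n; have h3 := pi_le4 R; have h4 := cut_lo_gt0 n.
  rewrite -addn3 natrD in h2.
  have h5 : 36 * A * cut_lo n <= n%:R * cut_lo n by rewrite ler_wpM2r// ltW.
  move: h1 h2 h3 h4 h5; move: (n%:R : R) (pi : R) (cut_lo n) (cut_re _) => N P x c h1 h2 h3 h4 h5.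
  move: k0; lra.
have a2 : (fun n => (cut_re (cut_hi n) - k) / cut_hi n) @ \oo --> +oo.
  apply/cvgryPge => A; have := nbhs_infty_ger (9 * (4 * `|A| + k)); apply: filterS => n hn.
  have /andP[h0 h1] := cut_hi_in n; rewrite ler_pdivlMr//.
  have h2 := cut_re_hi_ge n; have h3 := pi_le4 R.
  have h4 : A * cut_hi n <= `|A| * 4.
    apply: (@le_trans _ _ (`|A| * cut_hi n)); first by rewrite ler_wpM2r ?ler_norm// ltW.
    by rewrite ler_wpM2l// (le_trans (ltW h1)).
  by move: hn h2 h4; move: (`|A|) (cut_re _) (n%:R : R) => *; lra.
have -> : - (pi : R) = - (pi / 2) - pi / 2 by lra.
rewrite /angle; apply: cvgB; last exact: (cvg_comp _ _ a2 (@cvgy_atan R)).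
rewrite (_ : (fun n => _) = (fun n => - atan ((k - cut_re (cut_lo n)) / cut_lo n))).
  by apply: cvgN; exact: (cvg_comp _ _ a1 (@cvgy_atan R)).
by apply/funext => n; rewrite -atanN -mulNr opprB.
Qed.

End Angle.

Section Limit.
Variables p q : R.
Hypotheses (p0 : 0 <= p) (q0 : 0 <= q).

Definition residue k := (1 + p * reps (k - p)) / (1 + q * reps (k - q)).

(** The curve starts on the left of [k] and ends at [+oo + i pi]: seen from [k] the
argument decreases from [pi] to 0, half a turn around the pole. *)
Lemma half_residue k : 0 <= k ->
  (fun n => scaled_integral k (ratio p q) cut_re cut_re' (cut_lo n) (cut_hi n) 1) @ \oo --> - pi * residue k.
Proof.
move=> k0; have [B [B0 Bim Bb]] := ratio_bounds p0 q0.
set u := (fun n => _); pose a n := residue k * angle k cut_re (cut_lo n) (cut_hi n).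
have ua n : 0 < cut_re (cut_hi n) - k ->
    `|u n - a n| <= B * cut_lo n + B * pi / (cut_re (cut_hi n) - k).
  move=> C0; apply: (@half_residue_truncated R k (ratio p q) (ratio' p q) cut_re cut_re' _ _ _ _ (cut_lo n) (cut_hi n) _ _ _ B _ _ _ _ (residue k) B) => //.
  - by move=> f x d fx df; exact: ratio_deriv.
  - by move=> T f t ft cf; exact: ratio'_cont.
  - exact: cut_re_deriv.
  - exact: cut_re'_cont.
  - exact: cut_lo_gt0.
  - exact: cut_lo_lt_hi.
  - exact: cut_hi_lt_pi.
  - exact: cut_re_ge.
  - by rewrite (le_trans _ k0)// oppr_le0.
  - move=> v /andP[v0 _]; apply: ratio_lim => //.
have aC : a @ \oo --> - pi * residue k.
  by rewrite mulrC; apply: cvgMr; exact: angle_cvg.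
have inv0 : (fun n => (cut_re (cut_hi n) - k)^-1) @ \oo --> 0.
  apply/gtr0_cvgV0; last exact: cut_re_hi_cvg.
  by have /cvgryPgt := cut_re_hi_cvg k; exact.
have e0 : (fun n => B * cut_lo n + B * pi / (cut_re (cut_hi n) - k)) @ \oo --> 0.
  have -> : 0 = B * 0 + B * pi * 0 by rewrite !mulr0 addr0.
  by apply: cvgD; apply: cvgMr; [exact: cut_lo_cvg|exact: inv0].
have ua0 : (fun n => u n - a n) @ \oo --> 0.
  apply: norm_cvg0; apply: (squeeze_cvgr _ (cvg_cst 0) e0).
  have /cvgryPgt/(_ 0) := cut_re_hi_cvg k; apply: filterS => n C0.
  by rewrite normr_ge0/= ua.
have := cvgD ua0 aC; rewrite add0r.
have uE : u = (fun n => u n - a n) + a by apply/funext => n; rewrite fctE /= subrK.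
by move=> h; rewrite uE; exact: h.
Qed.

End Limit.
End Curve.

(** * The integral representation of Phi *)

Section MainIdentity.
Variable R : realType.
Local Notation re := (@complex.Re R).
Local Notation im := (@complex.Im R).
Local Notation mu := (@lebesgue_measure R).
Implicit Types p q v : R.

(** Minus the real number [w e^w] at the point [w] of the boundary curve. *)
Definition height v : R := v * expR (cut_re v) / sin v.

(** [|1 + w|^2 (|w|^2 - p^2) / |w - p|^4] at the point [w = cut_re v + i v]. *)
Definition density p v : R :=
  ((1 + cut_re v) ^+ 2 + v ^+ 2) * (cut_re v ^+ 2 + v ^+ 2 - p ^+ 2) /
  ((cut_re v - p) ^+ 2 + v ^+ 2) ^+ 2.

Lemma height_gt0 v : 0 < v < pi -> 0 < height v.
Proof.
move=> vpi; have s0 := sin_gt0_pi vpi; have /andP[v0 _] := vpi.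
by rewrite divr_gt0// mulr_gt0// expR_gt0.
Qed.

(** The modulus of [w] is [v / sin v]. *)
Lemma cut_modulus_ge1 v : 0 < v < pi -> 1 <= cut_re v ^+ 2 + v ^+ 2.
Proof.
move=> vpi; have s0 := sin_gt0_pi vpi; have /andP[v0 _] := vpi.
have -> : cut_re v ^+ 2 + v ^+ 2 = v ^+ 2 / sin v ^+ 2.
  rewrite /cut_re -[X in _ = X / _]mulr1 -(cos2Dsin2 v).
  by move: (sin v) (cos v) s0 => S C S0; field; rewrite gt_eqF.
rewrite ler_pdivlMr ?exprn_gt0// mul1r ler_pXn2r ?nnegrE ?(ltW s0) ?(ltW v0)//.
exact: sin_le_id (ltW v0).
Qed.

(** This is where [p <= 1] is used, hence [a <= e] in the theorem. *)
Lemma density_ge0 p v : 0 <= p <= 1 -> 0 < v < pi -> 0 <= density p v.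
Proof.
move=> /andP[p0 p1] vpi; rewrite /density divr_ge0 ?sqr_ge0// mulr_ge0//.
  by rewrite addr_ge0// sqr_ge0.
rewrite subr_ge0 (le_trans _ (cut_modulus_ge1 vpi))//.
by rewrite expr_le1.
Qed.

Lemma cut_re_cont v : 0 < v < pi -> {for v, continuous (@cut_re R)}.
Proof. by move=> /cut_re_deriv[d _]; exact/differentiable_continuous/derivable1_diffP. Qed.

Lemma height_cont v : 0 < v < pi -> {for v, continuous height}.
Proof.
move=> vpi; have s0 := sin_gt0_pi vpi.
apply: cvgM; last by apply: cvgV; [rewrite gt_eqF|exact: continuous_sin].
apply: cvgM; first exact: cvg_id.
apply: (@cvg_comp _ _ _ _ expR _ _ _ (cut_re_cont vpi)).
exact: continuous_expR.
Qed.

Lemma density_cont p v : 0 < v < pi -> {for v, continuous (density p)}.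
Proof.
move=> vpi; have c := cut_re_cont vpi; have /andP[v0 _] := vpi.
have sq (f : R -> R) : {for v, continuous f} -> {for v, continuous (fun x => f x ^+ 2)}.
  move=> cf; rewrite (_ : (fun x => _) = (fun x => f x * f x)); first exact: cvgM.
  by apply/funext => x; rewrite expr2.
have cid : {for v, continuous (fun x : R => x)} by exact: cvg_id.
apply: cvgM; first apply: cvgM.
- by apply: cvgD; apply: sq => //; apply: cvgD => //; exact: cvg_cst.
- by apply: cvgB; [apply: cvgD; exact: sq|exact: cvg_cst].
- apply: cvgV; first by rewrite expf_neq0// gt_eqF// ltr_wpDl ?sqr_ge0// exprn_gt0.
  apply: (sq (fun x => _ + _)).
  by apply: cvgD; apply: sq => //; apply: cvgB => //; exact: cvg_cst.
Qed.

Definition xexp p : R := p * expR p.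

Lemma xexp_ge0 p : 0 <= p -> 0 <= xexp p.
Proof. by move=> p0; rewrite mulr_ge0// expR_ge0. Qed.

Section OnCut.
Variables v : R.
Hypothesis vpi : 0 < v < pi.
Let w : R[i] := cut_re v +i* v.
Let v0 : 0 < v. Proof. by case/andP: vpi. Qed.
Let s0 : 0 < sin v. Proof. exact: sin_gt0_pi. Qed.
Let h0 : 0 < height v. Proof. exact: height_gt0. Qed.

(** On the boundary curve [exp (- w) = - w / height v]. *)
Lemma cexp_cut p : cexp (- (w - p%:C)) = - ((expR p / height v)%:C * w).
Proof.
rewrite /cexp /w; apply/eqP; rewrite eq_complex /= !mul0r subr0 addr0 oppr0 addr0.
rewrite opprB cosN sinN expRB /height.
have cE : cut_re v = - (v * cos v / sin v) by [].
move: (expR_gt0 (cut_re v)) s0 v0 cE; move: (expR (cut_re v)) (expR p) => e E.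
move: (cut_re v) (sin v) (cos v) => c S C e0 S0 V0 ->.
by apply/andP; split; apply/eqP; field; rewrite !gt_eqF.
Qed.

Lemma factor_cut p : factor p w = ((height v + xexp p) / height v)%:C * w / (w - p%:C).
Proof.
have w0 : 0 < im w by [].
apply: (mulIf (shift_neq0 p w0)); rewrite factor_shift// cexp_cut divfK ?shift_neq0//.
have -> : (height v + xexp p) / height v = 1 + p * (expR p / height v).
  by rewrite /xexp mulrDl divff ?gt_eqF// mulrA.
move: (expR p / _) => u; rewrite !complexE.
by move: (u%:C) (p%:C) w => x y z; ring.
Qed.

(** On the boundary curve [w e^w] is real, so only the rational factor of the
contour integrand is not real. *)
Lemma ratio_cut p q : 0 <= q -> ratio p q w =
  ((height v + xexp p) / (height v + xexp q))%:C * ((w - q%:C) / (w - p%:C)).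
Proof.
move=> q0; have w0 : 0 < im w by [].
rewrite /ratio !factor_cut.
have wn : w != 0 by apply: neq0_im; rewrite gt_eqF.
have hq : (height v + xexp q)%:C != 0.
  by rewrite fmorph_eq0 gt_eqF// ltr_pwDl// xexp_ge0.
have hh : (height v)%:C != 0 by rewrite fmorph_eq0 gt_eqF.
move: hq hh (shift_neq0 p w0) (shift_neq0 q w0) wn.
move: (height v + xexp p) (height v + xexp q) (height v) => a b c.
rewrite !complexE; move: (w - p%:C) (w - q%:C) w (a%:C) (b%:C) (c%:C) => x y z A B C *.
by field; do ?[apply/andP; split].
Qed.

Lemma cut_re'E : cut_re' v = (cut_re v + cut_re v ^+ 2 + v ^+ 2) / v.
Proof.
rewrite /cut_re' /cut_re.
have -> : v - sin v * cos v = v * (cos v ^+ 2 + sin v ^+ 2) - sin v * cos v.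
  by rewrite cos2Dsin2 mulr1.
by move: (sin v) (cos v) s0 v0 => S C S0 v0'; field; rewrite !gt_eqF.
Qed.

(** Since [w e^w] is real along the curve, so is its logarithmic derivative
[(1 + w) w' / w]. *)
Lemma tangent_cut : (1 + w) * tangent (@cut_re' R) v =
  (((1 + cut_re v) ^+ 2 + v ^+ 2) / v)%:C * w.
Proof.
rewrite /tangent cut_re'E /w; apply/eqP; rewrite eq_complex /= !mul0r subr0 addr0.
move: (cut_re v) v0 => c v0'.
by apply/andP; split; apply/eqP; field; rewrite gt_eqF.
Qed.

Lemma im_cut p : im (w / (w - p%:C) ^+ 2) =
  v * (p ^+ 2 - (cut_re v ^+ 2 + v ^+ 2)) / ((cut_re v - p) ^+ 2 + v ^+ 2) ^+ 2.
Proof.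
rewrite Im_div expr2 Re_mul Im_mul Re_shift Im_shift /w /=.
have n0 : (cut_re v - p) ^+ 2 + v ^+ 2 != 0.
  by rewrite gt_eqF// ltr_wpDl ?sqr_ge0// exprn_gt0.
move: (cut_re v) v0 n0 => c v0' n0.
field; rewrite n0 /=.
have -> : ((c - p) * (c - p) - v * v) ^+ 2 + ((c - p) * v + v * (c - p)) ^+ 2 =
  ((c - p) ^+ 2 + v ^+ 2) ^+ 2 by ring.
by rewrite expf_neq0.
Qed.

(** The two simple poles recombine through
[(1 + q) / (w - q) - (1 + p) / (w - p) = (q - p) (1 + w) / ((w - q) (w - p))]. *)
Lemma integrand_cut p q : 0 <= q ->
  (1 + q) * integrand q (ratio p q) (@cut_re R) (@cut_re' R) 1 v -
  (1 + p) * integrand p (ratio p q) (@cut_re R) (@cut_re' R) 1 v =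
  - (q - p) * (density p v * ((height v + xexp p) / (height v + xexp q))).
Proof.
move=> q0; have w0 : 0 < im w by [].
have scE k : scaled k (@cut_re R) 1 v = w.
  apply/eqP; rewrite eq_complex Re_scaled Im_scaled !mul1r /w /=.
  by rewrite addrC subrK !eqxx.
have chE k : chord k (@cut_re R) v = w - k%:C.
  by apply/eqP; rewrite eq_complex /chord /w /= subr0 !eqxx.
rewrite /integrand !scE !chE -!Im_scale -Im_opp -Im_add ratio_cut//.
set rho := _ / _; set t := tangent _ v; clearbody rho.
have -> : (1 + q)%:C * (rho%:C * ((w - q%:C) / (w - p%:C)) * (t / (w - q%:C))) -
   (1 + p)%:C * (rho%:C * ((w - q%:C) / (w - p%:C)) * (t / (w - p%:C))) =
   (rho * (q - p))%:C * ((1 + w) * t / (w - p%:C) ^+ 2).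
  rewrite !complexE.
  have := shift_neq0 p w0; have := shift_neq0 q w0.
  move: (p%:C) (q%:C) (rho%:C) w t => P Q r z y n1 n2.
  by field; rewrite n1 n2.
rewrite tangent_cut -mulrA !Im_scale im_cut /density.
have n0 : (cut_re v - p) ^+ 2 + v ^+ 2 != 0.
  by rewrite gt_eqF// ltr_wpDl ?sqr_ge0// exprn_gt0.
move: (cut_re v) rho v0 n0 => c r v0' n0.
by field; rewrite n0 gt_eqF.
Qed.

End OnCut.

Definition spectral p q v : R := density p v * ((height v + xexp p) / (height v + xexp q)).

Lemma spectral_ge0 p q v : 0 <= p <= 1 -> 0 <= q -> 0 < v < pi -> 0 <= spectral p q v.
Proof.
move=> p01 q0 vpi; have h := height_gt0 vpi; have /andP[p0 _] := p01.
rewrite mulr_ge0 ?density_ge0// divr_ge0// addr_ge0 ?xexp_ge0//; exact: ltW.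
Qed.

Lemma spectral_cont p q v : 0 <= q -> 0 < v < pi -> {for v, continuous (spectral p q)}.
Proof.
move=> q0 vpi; apply: cvgM; first exact: density_cont.
have h := height_gt0 vpi; have hc := height_cont vpi.
apply: cvgM; first by apply: cvgD => //; exact: cvg_cst.
apply: cvgV; first by rewrite gt_eqF// ltr_pwDl// xexp_ge0.
by apply: cvgD => //; exact: cvg_cst.
Qed.

Lemma cut_lo_hi_in n v : cut_lo R n <= v <= cut_hi R n -> 0 < v < pi.
Proof.
move=> /andP[h1 h2]; rewrite (lt_le_trans (cut_lo_gt0 R n) h1).
by rewrite (le_lt_trans h2 (cut_hi_lt_pi R n)).
Qed.

Lemma scaled_integral_cut p q n : 0 <= p -> 0 <= q ->
  (1 + q) * scaled_integral q (ratio p q) (@cut_re R) (@cut_re' R) (cut_lo R n) (cut_hi R n) 1 -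
  (1 + p) * scaled_integral p (ratio p q) (@cut_re R) (@cut_re' R) (cut_lo R n) (cut_hi R n) 1 =
  - (q - p) * \int[mu]_(v in `[cut_lo R n, cut_hi R n]) spectral p q v.
Proof.
move=> p0 q0; have mD : measurable (`[cut_lo R n, cut_hi R n] : set R) by exact: measurable_itv.
have kc k (v : R) : cut_lo R n <= v <= cut_hi R n ->
    {for v, continuous (integrand k (ratio p q) (@cut_re R) (@cut_re' R) 1)}.
  move=> lv.
  apply: (@integrand_cont R k (ratio p q) (ratio' p q) _ _ _ _ _ (cut_lo R n) (cut_hi R n)) => //.
  - by move=> f x d fx df; exact: ratio_deriv.
  - exact: cut_re_deriv.
  - exact: cut_re'_cont.
  - exact: cut_lo_gt0.
  - exact: cut_hi_lt_pi.
  - by rewrite mul1r cut_hi_lt_pi.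
have ik k : mu.-integrable `[cut_lo R n, cut_hi R n]
    (EFin \o integrand k (ratio p q) (@cut_re R) (@cut_re' R) 1).
  by apply: integrable_closed => v; exact: kc.
have is_ : mu.-integrable `[cut_lo R n, cut_hi R n] (EFin \o spectral p q).
  by apply: integrable_closed => v lv; apply: spectral_cont => //; exact: cut_lo_hi_in lv.
have iz k x : mu.-integrable `[cut_lo R n, cut_hi R n]
    (EFin \o (fun v => x * integrand k (ratio p q) (@cut_re R) (@cut_re' R) 1 v)).
  apply: integrable_closed => v lv; apply: cvgM; first exact: cvg_cst.
  exact: kc lv.
rewrite /scaled_integral -!RintegralZl// -RintegralB//.
apply: eq_Rintegral => v; rewrite inE/= in_itv/= => lv.
exact: integrand_cut (cut_lo_hi_in lv) _ _ q0.
Qed.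

(** The value of [F0] at the point [z] of coordinate [q = W(a (1 + z))], and the
opposite of the value of [F1] at the point of coordinate [q = W(a / (1 + z))]. *)
Definition Phi p q : R := (q - p * expR (p - q)) / (q - p) ^+ 2.

Lemma residue_diff p q : 0 <= p -> 0 <= q -> q != p ->
  ((1 + q) * residue p q q - (1 + p) * residue p q p) / (q - p) =
  Phi p q - (1 + p) ^+ 2 / (q * expR (q - p) - p).
Proof.
move=> p0 q0 qp.
have qp0 : q - p != 0 by rewrite subr_eq0.
have pq0 : p - q != 0 by rewrite -opprB oppr_eq0.
have r0 : 1 + q * reps (p - q) != 0.
  by rewrite gt_eqF// ltr_pwDl// mulr_ge0// ltW// reps_gt0.
have rE : 1 + q * reps (p - q) = (q * expR (q - p) - p) / (q - p).
  by rewrite /reps (negbTE pq0) opprB; move: (expR _) => e; field; rewrite pq0 qp0.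
have d0 : q * expR (q - p) - p != 0.
  by apply: contraNneq r0 => h; rewrite rE h mul0r.
rewrite /residue rE /Phi {1}/reps (negbTE qp0) opprB !subrr /reps eqxx.
move: d0; move: (expR (q - p)) (expR (p - q)) => e f d0.
have q1 : 1 + q != 0 by rewrite gt_eqF// ltr_pwDl.
by field; rewrite d0 qp0/= q1.
Qed.

Lemma spectral_cvg p q : 0 <= p -> 0 <= q -> q != p ->
  (fun n => \int[mu]_(v in `[cut_lo R n, cut_hi R n]) spectral p q v) @ \oo -->
  pi * (Phi p q - (1 + p) ^+ 2 / (q * expR (q - p) - p)).
Proof.
move=> p0 q0 qp; rewrite -residue_diff//.
have qp0 : q - p != 0 by rewrite subr_eq0.
have lq := half_residue p0 q0 q0; have lp := half_residue p0 q0 p0.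
rewrite (_ : (fun n => _) = (fun n => - (q - p)^-1 *
  ((1 + q) * scaled_integral q (ratio p q) (@cut_re R) (@cut_re' R) (cut_lo R n) (cut_hi R n) 1 -
  (1 + p) * scaled_integral p (ratio p q) (@cut_re R) (@cut_re' R) (cut_lo R n) (cut_hi R n) 1))); last first.
  by apply/funext => n; rewrite scaled_integral_cut// mulrA mulrNN mulVf// mul1r.
rewrite (_ : pi * _ = - (q - p)^-1 * ((1 + q) * (- pi * residue p q q)
   - (1 + p) * (- pi * residue p q p))); last first.
  by move: (pi : R) (residue _ _ _) (residue _ _ _) => x y z; field.
by apply: cvgMr; apply: cvgB; apply: cvgMr.
Qed.

Lemma cut_lo_hi_cover : \bigcup_n `[cut_lo R n, cut_hi R n]%classic = `]0, pi[%classic.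
Proof.
apply/seteqP; split => v /=.
  by move=> [n _]; rewrite /= !in_itv/=; exact: cut_lo_hi_in.
rewrite in_itv/= => /andP[v0 vpi].
have : \forall n \near \oo, cut_lo R n < Num.min v (pi - v).
  have m0 : 0 < Num.min v (pi - v) by rewrite lt_min v0 subr_gt0.
  exact: (cvgr_lt _ (@cut_lo_cvg R) _ m0).
move=> [n _ /(_ n (leqnn n))]; rewrite /= lt_min => /andP[h1 h2].
by exists n => //=; rewrite in_itv/= (ltW h1)/= /cut_hi lerBrDr -lerBrDl ltW.
Qed.

(** The right-hand side is the sum of the two half residues, at [q] and at [p]. *)
Lemma spectral_integral p q : 0 <= p <= 1 -> 0 <= q -> q != p ->
  (\int[mu]_(v in `]0%R, pi[) (spectral p q v)%:E =
  (pi * (Phi p q - (1 + p) ^+ 2 / (q * expR (q - p) - p)))%:E)%E.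
Proof.
move=> p01 q0 qp; have /andP[p0 _] := p01.
have is_ n : mu.-integrable `[cut_lo R n, cut_hi R n] (EFin \o spectral p q).
  by apply: integrable_closed => v lv; apply: spectral_cont => //; exact: cut_lo_hi_in lv.
have h := @ge0_nondecreasing_set_cvg_integral _ (measurableTypeR R) R
  (fun n => `[cut_lo R n, cut_hi R n]%classic) (fun v => (spectral p q v)%:E) mu.
rewrite -cut_lo_hi_cover.
have c2 : (\int[mu]_(x in `[cut_lo R n, cut_hi R n]) (spectral p q x)%:E)%E @[n --> \oo] -->
   (pi * (Phi p q - (1 + p) ^+ 2 / (q * expR (q - p) - p)))%:E.
  rewrite (_ : (fun n => _) =
    (fun n => (\int[mu]_(x in `[cut_lo R n, cut_hi R n]) spectral p q x)%:E)).
    by apply: cvg_EFin; [exact: nearW|exact: spectral_cvg].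
  by apply/funext => n; rewrite /Rintegral fineK//; exact: integrable_fin_num.
apply: (cvg_unique _ (h _ _ _ _) c2).
- exact: ereal_hausdorff.
- move=> n m nm; apply/subsetPset => v; rewrite /= !in_itv/= => /andP[h1 h2].
  have lnm : cut_lo R m <= cut_lo R n.
    by rewrite /cut_lo ler_pM2l ?pi_gt0// lef_pV2 ?posrE ?ltr0n// ler_nat.
  by rewrite (le_trans lnm h1) (le_trans h2)// /cut_hi lerB.
- by move=> n; exact: measurable_itv.
- by move=> n; exact: (measurable_int mu (is_ n)).
- by move=> n v; rewrite /= in_itv/= => /cut_lo_hi_in vpi; rewrite lee_fin spectral_ge0.
Qed.

End MainIdentity.

(** * Measures with a density *)

Section DensityMeasure.
Context d (T : measurableType d) (R : realType).
Variables (mu : {measure set T -> \bar R}) (rho : T -> R).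
Hypothesis rho_ge0 : forall x, 0 <= rho x.
Hypothesis rho_meas : measurable_fun [set: T] rho.
Local Open Scope ereal_scope.

Let density_integral (A : set T) : \bar R := \int[mu]_(x in A) (rho x)%:E.

Let with_density0 : density_integral set0 = 0.
Proof. by rewrite /density_integral integral_set0. Qed.

Let with_density_ge0 A : 0 <= density_integral A.
Proof. by apply: integral_ge0 => x _; rewrite lee_fin. Qed.

Let rho_measE (A : set T) : measurable_fun A (EFin \o rho).
Proof. by apply: measurable_funTS; exact/measurable_EFinP. Qed.

Let with_density_sigma_additive : semi_sigma_additive density_integral.
Proof.
move=> /= F mF tF mUF; rewrite /density_integral; apply: cvg_toP.
  apply: ereal_nondecreasing_is_cvgn => m n mn.
  by apply: lee_sum_nneg_natr => // k _ _; exact: with_density_ge0.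
by rewrite ge0_integral_bigcup//= => x _; rewrite lee_fin.
Qed.

Definition with_density : {measure set T -> \bar R} := HB.pack_for {measure set T -> \bar R}
  density_integral (isMeasure.Build _ _ _ density_integral
  with_density0 with_density_ge0 with_density_sigma_additive).

Import HBNNSimple.

(** Both sides are linear and continuous along increasing sequences, so it is
enough to treat indicators, for which it is the definition. *)
Lemma integral_with_density (f : T -> \bar R) :
  (forall x, 0 <= f x) -> measurable_fun setT f ->
  \int[with_density]_x f x = \int[mu]_x (f x * (rho x)%:E).
Proof.
move=> f0 mf.
pose h := nnsfun_approx measurableT mf.
have mrho := @rho_measE setT.
have hm n (r : R) : measurable (h n @^-1` [set r]) by exact: measurable_sfunP.
have lim_nu : \int[with_density]_x f x =
    lim (\int[with_density]_x (h n x)%:E @[n --> \oo]).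
  have fE x : f x = lim ((h n x)%:E @[n --> \oo]).
    by apply/esym/cvg_lim => //; exact: cvg_nnsfun_approx.
  under eq_integral do rewrite fE.
  apply: monotone_convergence => //.
  - by move=> n; exact/measurable_EFinP.
  - by move=> n x _; rewrite lee_fin.
  - by move=> x _ a b ab; rewrite lee_fin; exact/lefP/nd_nnsfun_approx.
have lim_mu : \int[mu]_x (f x * (rho x)%:E) =
    lim (\int[mu]_x ((h n x)%:E * (rho x)%:E) @[n --> \oo]).
  have fE x : f x * (rho x)%:E = lim ((h n x)%:E * (rho x)%:E @[n --> \oo]).
    by apply/esym/cvg_lim => //; apply: cvgeZr => //; exact: cvg_nnsfun_approx.
  under eq_integral do rewrite fE.
  apply: monotone_convergence => //.
  - by move=> n; apply: emeasurable_funM => //; exact/measurable_EFinP.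
  - by move=> n x _; rewrite mule_ge0// lee_fin.
  - by move=> x _ a b ab; rewrite lee_wpmul2r ?lee_fin//; exact/lefP/nd_nnsfun_approx.
rewrite lim_nu lim_mu; congr (lim (_ @ \oo)); apply/funext => n.
have indich r : measurable_fun setT (fun x => (r * \1_(h n @^-1` [set r]) x)%:E).
  exact/measurable_EFinP/measurable_funM.
transitivity (\int[with_density]_x
   (\sum_(y \in range (h n)) (y * \1_(h n @^-1` [set y]) x)%:E)).
  by apply: eq_integral => t _; rewrite /= fimfunE -fsumEFin.
rewrite ge0_integral_fsum//; last by move=> m y _; exact: nnfun_muleindic_ge0.
transitivity (\int[mu]_x (\sum_(y \in range (h n))
    (y * \1_(h n @^-1` [set y]) x)%:E * (rho x)%:E)); last first.
  apply: eq_integral => x _.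
  rewrite -ge0_mule_fsuml => [|y]; last exact: nnfun_muleindic_ge0.
  by rewrite fsumEFin // -(fimfunE _ x).
rewrite ge0_integral_fsum//; last 2 first.
  - by move=> y; exact: emeasurable_funM.
  - move=> y x _; apply: mule_ge0; last by rewrite lee_fin.
    exact: nnfun_muleindic_ge0.
apply: eq_fsbigr => r _.
have [r0|r0] := leP 0%R r; last first.
  have e0 : h n @^-1` [set r] = set0 by exact: preimage_nnfun0.
  rewrite e0 !integral0_eq// => x _; by rewrite indic0 mulr0 ?mul0e.
rewrite (integralZl_indic _ (fun r => h n @^-1` [set r]))//; last first.
  by move=> r1; exact: preimage_nnfun0.
rewrite integral_indic// setIT.
under [RHS]eq_integral do rewrite EFinM -muleA.
rewrite ge0_integralZl//; last 2 first.
  - by apply: emeasurable_funM => //; exact/measurable_EFinP.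
  - by move=> x _; apply: mule_ge0; rewrite lee_fin.
congr (_ * _).
rewrite -[LHS]/(\int[mu]_(x in h n @^-1` [set r]) (rho x)%:E) integral_mkcond.
by apply: eq_integral => x _; rewrite epatch_indic muleC.
Qed.

End DensityMeasure.

(** * From the representation to Stieltjes functions *)

Section Representation.
Variable R : realType.
Local Notation mu := (@lebesgue_measure R).

(** The representing measure is [m] times the Dirac mass at 0 plus the image under
[t] of the measure of density [k] on [(0, pi)].  Its integrability at
infinity is the finiteness of the representation at [x = 1]. *)
Lemma Stieltjes_of_density (alpha m : R) (k t f : R -> R) :
  0 <= alpha -> 0 <= m ->
  (forall v : R, 0 < v < pi -> 0 <= k v) -> (forall v : R, 0 < v < pi -> 0 <= t v) ->
  (forall v : R, 0 < v < pi -> {for v, continuous k}) ->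
  (forall v : R, 0 < v < pi -> {for v, continuous t}) ->
  (forall x : R, 0 < x -> ((f x)%:E = (alpha + m / x)%:E +
     \int[mu]_(v in `]0%R, pi[) (k v / (x + t v))%:E)%E) ->
  Stieltjes f.
Proof.
move=> alpha0 m0 k0 t0 ck ct fE.
pose I : set (measurableTypeR R) := `]0, pi[%classic.
have mI : measurable I by exact: measurable_itv.
have cont_meas (g : R -> R) : (forall v : R, 0 < v < pi -> {for v, continuous g}) ->
    measurable_fun [set: measurableTypeR R] (g \_ I).
  move=> cg; apply/(measurable_restrictT _ mI).
  apply: open_continuous_measurable_fun; first exact: interval_open.
  by move=> v; rewrite inE /I /= in_itv/=; exact: cg.
have rest0 (g : R -> R) : (forall v : R, 0 < v < pi -> 0 <= g v) -> forall v, 0 <= (g \_ I) v.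
  move=> g0 v; rewrite patchE; case: ifPn => //.
  by rewrite inE /I /= in_itv/=; exact: g0.
pose rho := k \_ I; have rho0 := rest0 _ k0; have mrho := cont_meas _ ck.
pose tt : measurableTypeR R -> measurableTypeR R := t \_ I.
have tt0 : forall v, 0 <= tt v := rest0 _ t0.
have mtt : measurable_fun [set: measurableTypeR R] tt := cont_meas _ ct.
pose nu : {measure set (measurableTypeR R) -> \bar R} := with_density mu rho0 mrho.
pose nut : {measure set (measurableTypeR R) -> \bar R} :=
  measure_function_pushforward__canonical__measure_function_Measure nu mtt.
pose D : set (measurableTypeR R) := `[0, +oo[%classic.
have mD : measurable D by exact: measurable_itv.
pose M : {measure set (measurableTypeR R) -> \bar R} :=
  measure_add (mscale (NngNum m0) (dirac (0 : measurableTypeR R))) nut.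
have ME (x : R) : 0 < x -> (\int[M]_(s in D) ((x + s)^-1)%:E =
    (m / x)%:E + \int[mu]_(v in `]0%R, pi[) (k v / (x + t v))%:E)%E.
  move=> x0; pose g (s : measurableTypeR R) : \bar R := ((x + s)^-1)%:E.
  have gD0 s : (0 <= (g \_ D) s)%E.
    rewrite patchE; case: ifPn => //; rewrite inE /D /= in_itv/= andbT => s0.
    by rewrite lee_fin invr_ge0 addr_ge0// ltW.
  have mgD : measurable_fun [set: measurableTypeR R] (g \_ D).
    apply/(measurable_restrictT _ mD); apply/measurable_EFinP.
    apply: subspace_continuous_measurable_fun => //.
    apply: continuous_in_subspaceT => s; rewrite inE /D /= in_itv/= andbT => s0.
    apply: cvgV; first by rewrite gt_eqF// ltr_wpDr.
    by apply: cvgD; [exact: cvg_cst|exact: cvg_id].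
  have -> : (\int[M]_(s in D) ((x + s)^-1)%:E = \int[M]_s (g \_ D) s)%E.
    by rewrite integral_mkcond.
  rewrite (ge0_integral_measure_add _ _ measurableT (fun s _ => gD0 s) mgD).
  rewrite (ge0_integral_mscale _ measurableT _ mgD (fun s _ => gD0 s)).
  rewrite (integral_dirac _ measurableT mgD) diracT mul1e.
  have -> : (g \_ D) 0 = (x^-1)%:E.
    by rewrite patchE mem_set /D ?/g ?addr0//= in_itv/= lexx.
  congr (_ + _)%E.
  have -> : (\int[nut]_s (g \_ D) s = \int[nu]_v ((g \_ D) \o tt) v)%E.
    by have := ge0_integral_pushforward mtt nu measurableT mgD (fun y _ => gD0 y);
      rewrite preimage_setT.
  rewrite (integral_with_density _ _ _ (fun v => gD0 (tt v))); last exact: measurableT_comp.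
  rewrite [RHS]integral_mkcond; apply: eq_integral => v _.
  have Dtt : D (tt v) by rewrite /D /= in_itv/= andbT tt0.
  rewrite /comp [in LHS]patchE mem_set// /g /rho /tt !patchE.
  case: ifPn => vI; last by rewrite mule0.
  by rewrite -EFinM mulrC.
exists alpha, M; split => //.
  have := fE 1 ltr01; rewrite EFinD -addeA -ME//.
  have : (0 <= \int[M]_(s in D) ((1 + s)^-1)%:E)%E.
    apply: integral_ge0 => s; rewrite /D /= in_itv/= andbT => s0.
    by rewrite lee_fin invr_ge0 addr_ge0.
  by case: (integral _ _ _) => // r _ _; rewrite ltry.
by move=> x x0; rewrite fE// EFinD -addeA -ME.
Qed.

Lemma xexp_lt (s t : R) : 0 <= s -> s < t -> xexp s < xexp t.
Proof. by move=> s0 st; apply: ltr_pM; rewrite ?expR_ge0 ?ltr_expR. Qed.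

Lemma xexp_lt_inv (s t : R) : 0 <= t -> xexp s < xexp t -> s < t.
Proof.
move=> t0 h; rewrite ltNge; apply/negP; rewrite le_eqVlt => /orP[/eqP e|ts].
  by move: h; rewrite e ltxx.
by have := lt_trans h (xexp_lt t0 ts); rewrite ltxx.
Qed.

Lemma spectral_meas (p q : R) : 0 <= q ->
  measurable_fun (`]0, pi[ : set (measurableTypeR R)) (spectral p q).
Proof.
move=> q0; apply: open_continuous_measurable_fun; first exact: interval_open.
by move=> v; rewrite inE /= in_itv/=; exact: spectral_cont.
Qed.

Lemma spectral_integral_pi (p q : R) : 0 <= p <= 1 -> 0 <= q -> q != p ->
  (\int[mu]_(v in `]0%R, pi[) (pi^-1 * spectral p q v)%:E =
  (Phi p q - (1 + p) ^+ 2 / (q * expR (q - p) - p))%:E)%E.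
Proof.
move=> p01 q0 qp; under eq_integral do rewrite EFinM.
rewrite ge0_integralZl//; last 3 first.
- by apply/measurable_EFinP; exact: spectral_meas.
- by move=> v; rewrite /= in_itv/= => vpi; rewrite lee_fin spectral_ge0.
- by rewrite lee_fin invr_ge0 pi_ge0.
by rewrite spectral_integral// -EFinM mulrA mulVf ?mul1r// gt_eqF// pi_gt0.
Qed.

Section Reparametrization.
Variable a : R.
Hypotheses (a0 : 0 < a) (ae : a <= expR 1).
Let p := lambertW a.

Let p0 : 0 < p. Proof. exact: lambertW_gt0. Qed.
Let pa : xexp p = a. Proof. exact: lambertW_expR. Qed.
Let p1 : p <= 1.
Proof.
rewrite leNgt; apply/negP => h.
have := xexp_lt ler01 h; rewrite pa /xexp mul1r => h'.
by have := le_lt_trans ae h'; rewrite ltxx.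
Qed.
Let p01 : 0 <= p <= 1. Proof. by rewrite p1 ltW. Qed.

Let mass : R := (1 + p) ^+ 2 / p.

Let mass0 : 0 <= mass.
Proof. by rewrite divr_ge0 ?sqr_ge0 ?ltW. Qed.

(** Everything is expressed through [z] by means of [q e^q = z p e^p]. *)
Lemma lambertW_shift (z q : R) : 0 < z -> 0 < q -> xexp q = a * z ->
  Phi p q = q * (1 - z^-1) / (q - p) ^+ 2 /\ q * expR (q - p) - p = p * (z - 1).
Proof.
move=> z0 q0 qz.
have e1 : p * expR (p - q) = q / z.
  rewrite expRB mulrA -/(xexp p) pa.
  have -> : q / z = a / expR q.
    have zn0 := lt0r_neq0 z0; have en0 := lt0r_neq0 (expR_gt0 q).
    by apply/eqP; rewrite eqr_div// -/(xexp q) qz.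
  by [].
have e2 : q * expR (q - p) = p * z.
  rewrite expRB mulrA -/(xexp q) qz -pa /xexp.
  by move: (lt0r_neq0 (expR_gt0 p)); move: (expR p) => e en0; field.
by rewrite /Phi e1 e2 !mulrBr !mulr1.
Qed.

Let k0 (v : R) : R := pi^-1 * (density p v * (1 + height v / a)).
Let t0 (v : R) : R := 1 + height v / a.

Lemma F0_is_Stieltjes : Stieltjes (fun z => F0 a z).
Proof.
have t0_0 (v : R) : 0 < v < pi -> 0 <= t0 v.
  by move=> vpi; rewrite /t0 addr_ge0// divr_ge0 ?(ltW a0)// ltW// height_gt0.
apply: (@Stieltjes_of_density 0 mass k0 t0) => //.
- move=> v vpi; rewrite /k0 mulr_ge0 ?invr_ge0 ?pi_ge0//.
  by apply: mulr_ge0; [exact: density_ge0|exact: t0_0].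
- move=> v vpi; apply: cvgMr; apply: cvgM; first exact: density_cont.
  by apply: cvgD; [exact: cvg_cst|apply: cvgMl; exact: height_cont].
- by move=> v vpi; apply: cvgD; [exact: cvg_cst|apply: cvgMl; exact: height_cont].
move=> x x0; have z0 : 0 < 1 + x by rewrite addr_gt0.
have az0 : 0 < a * (1 + x) by rewrite mulr_gt0.
pose q := lambertW (a * (1 + x)).
have q0 : 0 < q by exact: lambertW_gt0.
have qz : xexp q = a * (1 + x) by exact: lambertW_expR.
have pq : p < q.
  by apply: xexp_lt_inv (ltW q0) _; rewrite pa qz ltr_pMr// ltrDl.
have [PhiE dE] := lambertW_shift z0 q0 qz.
have F0E : F0 a x = Phi p q.
  rewrite PhiE /F0 -/p -/q; field.
  by rewrite subr_eq0 gt_eqF// gt_eqF.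
have -> : (\int[mu]_(v in `]0%R, pi[) (k0 v / (x + t0 v))%:E =
    \int[mu]_(v in `]0%R, pi[) (pi^-1 * spectral p q v)%:E)%E.
  apply: eq_integral => v; rewrite inE /= in_itv/= => vpi; congr EFin.
  have h0 := height_gt0 vpi.
  rewrite /k0 /t0 /spectral pa qz -[LHS]mulrA -[X in _ * X = _]mulrA; congr (_ * (_ * _)).
  have d0 : height v + a * (1 + x) != 0 by rewrite gt_eqF// addr_gt0// mulr_gt0.
  have d1 : x + (1 + height v / a) = (height v + a * (1 + x)) / a.
    by field; rewrite gt_eqF.
  rewrite d1; move: (height v) (a * (1 + x)) d0 => h A d0.
  by field; rewrite d0 gt_eqF.
rewrite spectral_integral_pi ?(ltW q0) ?gt_eqF// -EFinD F0E dE; congr EFin.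
have xn0 := lt0r_neq0 x0; have pn0 := lt0r_neq0 p0.
have -> : 1 + x - 1 = x by ring.
by rewrite /mass; move: (Phi p q) => F; field; rewrite xn0 pn0.
Qed.

Let k1 (v : R) : R := pi^-1 * (density p v * (height v + a) * a / height v ^+ 2).
Let t1 (v : R) : R := 1 + a / height v.

(** [F1] is [- Phi p q] with [0 < q < p].  Subtracting the identities for [q] and for
[0] leaves the positive density [density p v (s + p e^p) (1 / s - 1 / (s + q e^q))]
and the constant [- Phi p 0 = e^p / p]. *)
Lemma F1_is_Stieltjes : Stieltjes (fun z => F1 a z).
Proof.
have k1_0 (v : R) : 0 < v < pi -> 0 <= k1 v.
  move=> vpi; have h0 := height_gt0 vpi.
  rewrite /k1 mulr_ge0 ?invr_ge0 ?pi_ge0// divr_ge0 ?sqr_ge0//.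
  have d0 := density_ge0 p01 vpi.
  by apply: mulr_ge0 (mulr_ge0 d0 (addr_ge0 (ltW h0) (ltW a0))) (ltW a0).
have t1_0 (v : R) : 0 < v < pi -> 0 <= t1 v.
  by move=> vpi; rewrite /t1 addr_ge0// divr_ge0 ?(ltW a0)// ltW// height_gt0.
have hV (v : R) : 0 < v < pi -> {for v, continuous (fun v => (height v)^-1)}.
  by move=> vpi; apply: cvgV; [rewrite gt_eqF// height_gt0|exact: height_cont].
have k1_c (v : R) : 0 < v < pi -> {for v, continuous k1}.
  move=> vpi; apply: cvgMr; apply: cvgM.
    apply: cvgMl; apply: cvgM; first exact: density_cont.
    by apply: cvgD; [exact: height_cont|exact: cvg_cst].
  rewrite (_ : (fun x => _) = (fun x => (height x)^-1 * (height x)^-1)).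
    by rewrite -exprVn expr2; apply: cvgM; exact: hV.
  by apply/funext => u; rewrite -exprVn expr2.
have t1_c (v : R) : 0 < v < pi -> {for v, continuous t1}.
  by move=> vpi; apply: cvgD; [exact: cvg_cst|apply: cvgMr; exact: hV].
have alpha0 : 0 <= expR p / p by rewrite divr_ge0 ?expR_ge0 ?ltW.
apply: (@Stieltjes_of_density (expR p / p) mass k1 t1) => // x x0.
have z0 : 0 < 1 + x by rewrite addr_gt0.
have az0 : 0 < a / (1 + x) by rewrite divr_gt0.
pose q := lambertW (a / (1 + x)).
have q0 : 0 < q by exact: lambertW_gt0.
have qz : xexp q = a / (1 + x) by exact: lambertW_expR.
have qp : q < p.
  apply: xexp_lt_inv (ltW p0) _; rewrite pa qz ltr_pdivrMr//.
  by rewrite ltr_pMr// ltrDl.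
have [|PhiE dE] := @lambertW_shift (1 + x)^-1 q _ q0 qz; first by rewrite invr_gt0.
have F1E : F1 a x = - Phi p q.
  have qp0 : q - p != 0 by rewrite subr_eq0 lt_eqF.
  have pq0 : p - q != 0 by rewrite subr_eq0 gt_eqF.
  by rewrite PhiE /F1 -/p -/q invrK; field; rewrite ?qp0 ?pq0.
have Sq := spectral_integral_pi p01 (ltW q0) (negbT (lt_eqF qp)).
have S0 := spectral_integral_pi p01 (lexx 0) (negbT (lt_eqF p0)).
(* the identity at q = 0 is the sum of the one at q and of the wanted integral *)
have split0 : (\int[mu]_(v in `]0%R, pi[) (pi^-1 * spectral p 0 v)%:E =
    \int[mu]_(v in `]0%R, pi[) (k1 v / (x + t1 v))%:E +
    \int[mu]_(v in `]0%R, pi[) (pi^-1 * spectral p q v)%:E)%E.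
  rewrite -ge0_integralD//.
  - apply: eq_integral => v; rewrite inE /= in_itv/= => vpi.
    rewrite -EFinD; congr EFin; have h0 := height_gt0 vpi.
    rewrite /k1 /t1 /spectral pa qz [in LHS]/xexp mul0r addr0.
    rewrite -[X in _ = X + _]mulrA -mulrDr; congr (_ * _).
    have d0 : height v + a / (1 + x) != 0 by rewrite gt_eqF// addr_gt0.
    have d1 : height v * (1 + x) + a != 0 by rewrite gt_eqF// addr_gt0// mulr_gt0.
    have -> : height v + a / (1 + x) = (height v * (1 + x) + a) / (1 + x).
      by field; rewrite gt_eqF.
    have -> : x + (1 + a / height v) = (height v * (1 + x) + a) / height v.
      by field; rewrite gt_eqF.
    move: (height v) (density p v) h0 d1 => h d h0 d1.
    by field; rewrite d1 !gt_eqF.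
  - move=> v; rewrite /= in_itv/= => vpi; rewrite lee_fin divr_ge0 ?k1_0//.
    by rewrite addr_ge0 ?t1_0// ltW.
  - apply/measurable_EFinP; apply: open_continuous_measurable_fun; first exact: interval_open.
    move=> v; rewrite inE /= in_itv/= => vpi; apply: cvgM; first exact: k1_c.
    apply: cvgV; first by rewrite gt_eqF// ltr_pwDl// t1_0.
    by apply: cvgD; [exact: cvg_cst|exact: t1_c].
  - move=> v; rewrite /= in_itv/= => vpi.
    by rewrite lee_fin mulr_ge0 ?invr_ge0 ?pi_ge0// spectral_ge0// ltW.
  - apply/measurable_EFinP; apply: measurable_funM; first exact: measurable_cst.
    by apply: spectral_meas; exact: ltW.
move: split0; rewrite S0 Sq F1E dE.
case: (integral _ _ _) => [r| |]//; rewrite -!EFinD => -[rE]; congr EFin.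
move: rE; rewrite mul0r sub0r {1}/Phi mulrBr mulr1 => rE.
have xn0 := lt0r_neq0 x0; have pn0 := lt0r_neq0 p0.
have xx0 := lt0r_neq0 z0.
have -> : r = mass - expR p / p - Phi p q - mass * (1 + x) / x.
  apply: (addIr (Phi p q - (1 + p) ^+ 2 / (p * (1 + x)^-1 - p))); rewrite -rE.
  rewrite /mass !sub0r subr0 sqrrN; move: (Phi p q) (expR p) => F e.
  field; rewrite pn0 xx0 xn0 /=.
  rewrite andbT (_ : _ + _ = - (p * x)); first by rewrite oppr_eq0 mulf_neq0.
  by ring.
rewrite /mass; move: (Phi p q) (expR p) => F e.
by field; rewrite xn0 pn0.
Qed.

End Reparametrization.
End Representation.

Theorem theorem2p5 (R : realType) (a : R) (ha0 : 0 < a) (hae : a <= expR 1) :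
  Stieltjes (fun z : R => F0 a z) /\ Stieltjes (fun z : R => F1 a z).
Proof. by split; [exact: F0_is_Stieltjes|exact: F1_is_Stieltjes]. Qed.
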